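(* Let $k$ be a field and let $d,m$ be integers with $d$ odd and $5\le d<m-1$. Set $a=(d+1)/2$, let $R=k[x_1,\dots,x_m,z_1,z_2]$ with all variables of degree $1$, and let $I=(I_{a,2,m-1},\, x_1x_mI_{a-1,3,m-2})$ and $J=(I_{a-1,2,m-2},\, z_1z_2 I_{a-2,3,m-3})$ be ideals of $R$ (so $I\subset J$). Let $\phi\in\operatorname{Hom}_{R/I}(J,R/I)$ be the unique homomorphism with $\phi(v)=0$ for all $v\in I_{a-1,2,m-2}$ and $\phi(z_1z_2w)=x_1x_{m-1}x_mw$ for all $w\in I_{a-2,3,m-3}$ (such $\phi$ exists, and $\operatorname{Hom}_{R/I}(J,R/I)$ is generated by $\phi$ and the inclusion). Let \[ S=\frac{(R/I)[T]}{(Tu-\phi(u)\mid u\in J)}, \] graded with $\deg T=1$. Then $z_1,z_2$ is an $S$-regular sequence, and there is an isomorphism of graded $k$-algebras $S/(z_1,z_2)\cong k[\Delta(d,m+1)]$.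
   Context: For positive integers $a,p,q$ with $p<q$ and $2a\le q-p+2$, $I_{a,p,q}$ denotes the ideal (of any polynomial ring containing $x_p,\dots,x_q$) generated by all monomials $x_{t_1}\cdots x_{t_a}$ with $p\le t_1$, $t_a\le q$ and $t_j+2\le t_{j+1}$ for $1\le j\le a-1$. For integers $2\le d<n$, $\Delta(d,n)$ denotes the boundary simplicial complex of the $d$-dimensional cyclic polytope with $n$ vertices, the convex hull in $\mathbb{R}^d$ of $f(t_1),\dots,f(t_n)$ with $t_1<\dots<t_n$ real and $f(t)=(t,\dots,t^d)$, vertex $i$ corresponding to $f(t_i)$; faces are $\emptyset$ and vertex sets of proper faces. $k[\Delta]$ is the standard graded Stanley–Reisner ring $k[x_1,\dots,x_n]/I_\Delta$, $I_\Delta$ generated by the squarefree monomials $\prod_{t\in W}x_t$ with $W\notin\Delta$. *)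

(* Defs.v *)
From HB Require Import structures.
From mathcomp Require Import all_boot all_order all_algebra.
From mathcomp Require Import reals.
From mathcomp Require Import mpoly.
Set Implicit Arguments. Unset Strict Implicit. Unset Printing Implicit Defensive.
Import Order.TTheory GRing.Theory Num.Theory.
Local Open Scope ring_scope.

Definition in_ideal {T : comNzRingType} (G : T -> Prop) (f : T) : Prop :=
  exists s : seq (T * T), (forall q, q \in s -> G q.2) /\
                          f = \sum_(q <- s) q.1 * q.2.

Definition gen_union {T : eqType} (G : T -> Prop) (xs : seq T) : T -> Prop :=
  fun f => G f \/ f \in xs.

Definition Igen {T : comNzRingType} (x : nat -> T) (a p q : nat) (f : T) : Prop :=
  exists t : seq nat,
    [/\ size t = a, sorted (fun i j => i.+2 <= j)%N t,
        all (fun i => p <= i <= q)%N t & f = \prod_(i <- t) x i].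

Definition Igens {T : comNzRingType} (x : nat -> T) (a m : nat) (f : T) : Prop :=
  Igen x a 2 m.-1 f \/
  exists w, Igen x a.-1 3 m.-2 w /\ f = x 1%N * x m * w.

Definition Jgens {T : comNzRingType} (x : nat -> T) (z1 z2 : T) (a m : nat)
    (f : T) : Prop :=
  Igen x a.-1 2 m.-2 f \/
  exists w, Igen x a.-2 3 (m - 3)%N w /\ f = z1 * z2 * w.

(* phi_rel u p : u is an element of J and p is a representative (in R) of
   phi(u mod I) in R/I, where phi is the R/I-linear map with phi(v) = 0 for
   v in I_{a-1,2,m-2} and phi(z1 z2 w) = x_1 x_{m-1} x_m w for w in
   I_{a-2,3,m-3}: u = sum r_i v_i + sum s_j z1 z2 w_j + (element of I),
   p = sum s_j x_1 x_{m-1} x_m w_j. *)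
Definition phi_rel {T : comNzRingType} (x : nat -> T) (z1 z2 : T) (a m : nat)
    (u p : T) : Prop :=
  exists (rs ss : seq (T * T)) (iota : T),
    [/\ (forall q, q \in rs -> Igen x a.-1 2 m.-2 q.2),
        (forall q, q \in ss -> Igen x a.-2 3 (m - 3)%N q.2),
        in_ideal (Igens x a m) iota,
        u = \sum_(q <- rs) q.1 * q.2 + \sum_(q <- ss) q.1 * (z1 * z2 * q.2) + iota
      & p = \sum_(q <- ss) q.1 * (x 1%N * x m.-1 * x m * q.2)].

(* The ring R = k[x_1..x_m, z_1, z_2] is {mpoly k[m.+2]}:
   x_i = 'X_(i-1) (1 <= i <= m), z_1 = 'X_m, z_2 = 'X_(m+1). *)
Definition xR (k : fieldType) (m i : nat) : {mpoly k[m.+2]} := 'X_(inord i.-1).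
Definition z1R (k : fieldType) (m : nat) : {mpoly k[m.+2]} := 'X_(inord m).
Definition z2R (k : fieldType) (m : nat) : {mpoly k[m.+2]} := 'X_(inord m.+1).

(* The ring R[T] = k[x_1..x_m, z_1, z_2, T] is {mpoly k[m.+3]}, same
   variables and T = 'X_(m+2). *)
Definition xP (k : fieldType) (m i : nat) : {mpoly k[m.+3]} := 'X_(inord i.-1).
Definition z1P (k : fieldType) (m : nat) : {mpoly k[m.+3]} := 'X_(inord m).
Definition z2P (k : fieldType) (m : nat) : {mpoly k[m.+3]} := 'X_(inord m.+1).
Definition TP (k : fieldType) (m : nat) : {mpoly k[m.+3]} := 'X_(inord m.+2).

Definition embRP (k : fieldType) (m : nat) (p : {mpoly k[m.+2]}) : {mpoly k[m.+3]} :=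
  p \mPo [tuple 'X_(widen_ord (leqnSn m.+2) i) | i < m.+2].

(* S = (R/I)[T] / (T u - phi(u) | u in J) = k[x,z,T] / L, where L is the
   ideal of k[x,z,T] generated by the following elements. *)
Definition Sgens (k : fieldType) (a m : nat) (f : {mpoly k[m.+3]}) : Prop :=
  Igens (xP k m) a m f \/
  exists u p, phi_rel (xR k m) (z1R k m) (z2R k m) a m u p /\
              f = TP k m * embRP u - embRP p.

Definition regular_seq {T : comNzRingType} (G : T -> Prop) (xs : seq T) : Prop :=
  (forall i, (i < size xs)%N -> forall f : T,
      in_ideal (gen_union G (take i xs)) (nth 0 xs i * f) ->
      in_ideal (gen_union G (take i xs)) f) /\
  ~ in_ideal (gen_union G xs) 1.

Definition linform {k : fieldType} {n : nat} (p : {mpoly k[n]}) : bool :=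
  all (fun mo => mdeg mo == 1%N) (msupp p).

(* Isomorphism of standard graded k-algebras k[X_1..X_p]/(GA) and
   k[Y_1..Y_q]/(GB): graded k-algebra maps in both directions (determined by
   the degree-1 images of the variables, lifted to linear forms), which are
   well defined on the quotients and mutually inverse. *)
Definition graded_iso {k : fieldType} {p q : nat}
    (GA : {mpoly k[p]} -> Prop) (GB : {mpoly k[q]} -> Prop) : Prop :=
  exists (f : p.-tuple {mpoly k[q]}) (g : q.-tuple {mpoly k[p]}),
    [/\ (forall i, linform (tnth f i)) /\ (forall j, linform (tnth g j)),
        (forall h, in_ideal GA h -> in_ideal GB (h \mPo f)),
        (forall h, in_ideal GB h -> in_ideal GA (h \mPo g)),
        (forall i : 'I_p, in_ideal GA ('X_i - (tnth f i \mPo g)))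
      & (forall j : 'I_q, in_ideal GB ('X_j - (tnth g j \mPo f)))].

(* Boundary complex of the cyclic polytope Delta(d,n) with vertices
   f(t_0),...,f(t_{n-1}), f(t) = (t, t^2, ..., t^d); vertex i : 'I_n stands
   for f(t_i).  W is a face iff W is empty or W is the vertex set of a proper
   face, i.e. W = {i | c.f(t_i) = b} for a supporting hyperplane c.y <= b of
   the polytope, with W not all vertices. *)
Definition cyc_face (R : realType) (d n : nat) (t : 'I_n -> R) (W : {set 'I_n}) : Prop :=
  W = set0 \/
  exists (c : 'I_d -> R) (b : R),
    [/\ (forall i, \sum_(j < d) c j * t i ^+ j.+1 <= b),
        W = [set i | \sum_(j < d) c j * t i ^+ j.+1 == b]
      & W != setT].

Definition SRgens (k : fieldType) (R : realType) (d n : nat) (t : 'I_n -> R)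
    (f : {mpoly k[n]}) : Prop :=
  exists W : {set 'I_n}, ~ cyc_face d t W /\ f = \prod_(i in W) 'X_i.

(* Main.v *)
Require Import Defs.
From HB Require Import structures.
From mathcomp Require Import all_boot all_order all_algebra.
From mathcomp Require Import reals.
From mathcomp Require Import mpoly.
From mathcomp Require Import boolp.
From mathcomp Require Import zify ring.
Import Order.TTheory GRing.Theory Num.Theory.
Set Implicit Arguments. Unset Strict Implicit. Unset Printing Implicit Defensive.
Local Open Scope ring_scope.

(* All ideals are governed by supports of monomials. A monomial avoids [I]
   exactly when its support is a face, i.e. has no [a] pairwise nonadjacent
   elements in [2, m-1] and, if it contains [1] and [m], no [a-1] such elements
   in [3, m-2]. Write [y = x_1 x_(m-1) x_m].

   Hom: if [psi(g)] has a nonzero coefficient at a face [mu] not containing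
   [i], for some [i] in a generator [g], then a generator [g'] avoiding [i]
   with [mu + g'] a face contradicts [g' psi(g) = g psi(g')]. So [psi(v)] is a
   multiple of each generator [v] of [I_(a-1,2,m-2)], and the cofactors agree
   because generators compatible with a given face are connected by chains of
   jointly compatible ones. Subtracting [alpha] times the inclusion, [psi]
   kills all [v], and the same argument makes [psi(z_1 z_2 w)] a multiple of
   [y w].

   Regularity: [y w --> T z_1 z_2 w] is a confluent rewriting system modulo
   [I] and the [T v]; its normal form map commutes with multiplication by
   [z_1]. Modulo [z_1] the ideal becomes monomial and free of [z_2].

   Isomorphism: sending [x_m] to the last vertex, [T] to the one before it and
   [z_1, z_2] to [0] matches this monomial ideal with the nonfaces of the cyclic
   polytope. A set is a face of the polytope iff a polynomial of degree at most
   [d = 2a-1] is nonnegative on the parameters and vanishes exactly on it;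
   products of [(X - t_i)(X - t_(i+1))] and boundary factors provide such
   polynomials, and the vanishing of the top divided difference excludes
   them. *)

(** * Spread sets of integers *)

Local Open Scope nat_scope.

(** One fact about supports carries the algebra: [y] times a monomial lying both in the ideal of the
    [v] and in the ideal of the [w] lies in [I] ([nface_colon]). It makes [phi] independent of the
    chosen representation of [u], and it settles the overlaps of the rewriting rule with the
    relations [T v]. The rule goes from [y w] to [T z_1 z_2 w] because its left side is then free of
    [z_1], so that multiplication by [z_1] creates no new reduction. Elements of [R/I] are compared
    through their coefficients at faces, which do not depend on a representative. Chains are needed
    because two generators that are compatible with a face need not be jointly compatible with it.
    The hypotheses on [d] and [m] enter as [3 <= a] and [2a < m]; the latter leaves room for the
    disjoint pairs of neighbours from which compatible generators are built. *)

Definition spread : rel nat := fun i j => i.+2 <= j.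

Lemma spread_trans : transitive spread.
Proof. by move=> y x z; rewrite /spread; lia. Qed.

Definition within (p q : nat) : pred nat := fun i => p <= i <= q.

Fixpoint nu_rec (W : pred nat) (len p : nat) : nat :=
  if len is len1.+1 then
    if W p then (if len1 is len2.+1 then nu_rec W len2 p.+2 else 0).+1
    else nu_rec W len1 p.+1
  else 0.

(* The largest size of a spread subset of [W] inside [p, q], found greedily. *)
Definition nu (W : pred nat) (p q : nat) : nat := nu_rec W (q.+1 - p) p.

Lemma nuE (W : pred nat) p q : p <= q ->
  nu W p q = if W p then (nu W p.+2 q).+1 else nu W p.+1 q.
Proof.
move=> le_pq; rewrite /nu.
have -> : q.+1 - p = (q - p).+1 by lia.
rewrite [in LHS]/=; case: ifP => _; last by congr nu_rec; lia.
congr _.+1; have -> : q.+1 - p.+2 = (q - p).-1 by lia.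
by case: (q - p).
Qed.

Lemma nu_empty (W : pred nat) p q : q < p -> nu W p q = 0.
Proof. by move=> lt_qp; rewrite /nu; have -> : q.+1 - p = 0 by lia. Qed.

Lemma nu_ind (P : nat -> Prop) (q : nat) :
  (forall p, q < p -> P p) ->
  (forall p, p <= q -> P p.+1 -> P p.+2 -> P p) -> forall p, P p.
Proof.
move=> P0 PS p.
have [n] : exists n, q.+1 - p <= n by exists (q.+1 - p).
elim/ltn_ind: n p => n IHn p le_n.
have [lt_qp|le_pq] := ltnP q p; first exact: P0.
case: n IHn le_n => [|n] IHn le_n; first by lia.
by apply: PS => //; apply: (IHn n) => //; lia.
Qed.

(** Exchange argument: if [p] is in [W], the first entry of [t] can be replaced by [p], since the
    later entries are at least [p+2] in any case. *)
Lemma nu_max (W : pred nat) p q t : pairwise spread t -> all (within p q) t -> all W t ->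
  size t <= nu W p q.
Proof.
move: p t; apply: (nu_ind (q := q)) => [p lt_qp|p le_pq IH1 IH2] t.
  by case: t => //= x t _ /andP[]; rewrite /within; lia.
rewrite nuE //; case: t => [|x t] //= /andP[ltx sp_t] /andP[x_in t_in] /andP[Wx W_t].
have t_after : all (within x.+2 q) t.
  apply/allP => y yt; move/allP/(_ _ yt): ltx; move/allP/(_ _ yt): t_in.
  by rewrite /within /spread; lia.
have wide r s : s <= r -> all (within r q) t -> all (within s q) t.
  by move=> le_sr; apply: sub_all => y; rewrite /within; lia.
case: ifP => Wp.
  rewrite ltnS; apply: IH2 => //; apply: wide t_after.
  by move: x_in; rewrite /within; lia.
have ne_xp : x != p by apply: contraFneq Wp => <-.
apply: (IH1 (x :: t)) => /=; first by rewrite ltx.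
  apply/andP; split; first by move: x_in ne_xp; rewrite /within; lia.
  by apply: wide t_after; move: x_in; rewrite /within; lia.
by rewrite Wx.
Qed.

Lemma nu_wit (W : pred nat) p q : exists t,
  [/\ size t = nu W p q, pairwise spread t, all (within p q) t & all W t].
Proof.
move: p; apply: (nu_ind (q := q)) => [p lt_qp|p le_pq IH1 IH2].
  by exists [::]; rewrite nu_empty.
rewrite nuE //; case: ifP => Wp.
  have [t [sz sp t_in Wt]] := IH2; exists (p :: t); split => /=.
  - by rewrite sz.
  - rewrite sp andbT; apply: sub_all t_in => y; rewrite /within /spread; lia.
  - apply/andP; split; first by rewrite /within; lia.
    by apply: sub_all t_in => y; rewrite /within; lia.
  - by rewrite Wp.
have [t [sz sp t_in Wt]] := IH1; exists t; split => //.
by apply: sub_all t_in => y; rewrite /within; lia.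
Qed.

Lemma nu_witn (W : pred nat) p q n : n <= nu W p q -> exists t,
  [/\ size t = n, pairwise spread t, all (within p q) t & all W t].
Proof.
move=> le_n; have [t [sz sp t_in Wt]] := nu_wit W p q.
exists (take n t); split.
- by rewrite size_takel // sz.
- by apply: subseq_pairwise sp; apply: take_subseq.
- by apply/allP => y /mem_take; apply/allP.
- by apply/allP => y /mem_take; apply/allP.
Qed.

Lemma nu_le (W W' : pred nat) p q p' q' :
  (forall i, p <= i <= q -> W i -> (p' <= i <= q') && W' i) ->
  nu W p q <= nu W' p' q'.
Proof.
move=> sub; have [t [<- sp t_in Wt]] := nu_wit W p q.
by apply: nu_max => //; apply/allP => y yt;
   have /andP[] := sub y (allP t_in _ yt) (allP Wt _ yt).
Qed.

Lemma nu_eq (W W' : pred nat) p q : (forall i, p <= i <= q -> W i = W' i) ->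
  nu W p q = nu W' p q.
Proof.
move=> eqW; apply/eqP; rewrite eqn_leq; apply/andP.
by split; apply: nu_le => i i_in; rewrite i_in eqW.
Qed.

Lemma nu_split (W : pred nat) p i q : nu W p q <= nu W p i + nu W i.+1 q.
Proof.
have [t [<- sp t_in Wt]] := nu_wit W p q.
rewrite -(count_predC (fun y => y <= i) t) -!size_filter.
by apply: leq_add; apply: nu_max;
  rewrite ?(subseq_pairwise (filter_subseq _ _) sp) //;
  apply/allP => y; rewrite mem_filter => /andP[/= ci yt]; rewrite ?(allP Wt _ yt) //;
  move: (allP t_in _ yt); rewrite /within; lia.
Qed.

Lemma nu_gap (W : pred nat) p i j q : i.+2 <= j -> p <= j -> i <= q ->
  nu W p i + nu W j q <= nu W p q.
Proof.
move=> lt_ij le_pj le_iq.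
have [t1 [<- sp1 in1 W1]] := nu_wit W p i.
have [t2 [<- sp2 in2 W2]] := nu_wit W j q.
rewrite -size_cat; apply: nu_max.
- rewrite pairwise_cat sp1 sp2 !andbT; apply/allrelP => x y x1 y2.
  by move: (allP in1 _ x1) (allP in2 _ y2); rewrite /within /spread; lia.
- rewrite all_cat; apply/andP; split; [apply: sub_all in1|apply: sub_all in2];
  by move=> x; rewrite /within; lia.
- by rewrite all_cat W1.
Qed.

Lemma nu_len (W : pred nat) p q : (nu W p q).*2 <= q.+2 - p.
Proof.
move: p; apply: (nu_ind (q := q)) => [p lt_qp|p le_pq IH1 IH2].
  by rewrite nu_empty.
by rewrite nuE //; case: ifP => _; lia.
Qed.

Lemma nu_full (W : pred nat) p q : (forall i, p <= i <= q -> W i) -> q.+1 - p <= (nu W p q).*2.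
Proof.
move: p; apply: (nu_ind (q := q)) => [p lt_qp|p le_pq IH1 IH2] Wall.
  by rewrite nu_empty //; lia.
rewrite nuE // Wall ?leqnn //.
have: q.+1 - p.+2 <= (nu W p.+2 q).*2 by apply: IH2 => i i_in; apply: Wall; lia.
lia.
Qed.

Lemma spread_size p q t : pairwise spread t -> all (within p q) t ->
  (size t).*2 <= q.+2 - p.
Proof.
move=> sp t_in; apply: leq_trans (nu_len predT p q).
by rewrite leq_double; apply: nu_max => //; apply/allP.
Qed.

(** The part of [W] in [p, q] is covered by [n] disjoint pairs {j, j+1}. A spread set meets each
    pair at most once, so filling the pairs keeps the count at most [n]. The set [t] takes the left
    ends of the pairs, or the right ends when [b] is true. *)
Lemma nu_extend (W : pred nat) (b : bool) n p q : nu W p q <= n -> n.*2 <= q.+1 - p -> exists t,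
  [/\ size t = n, pairwise spread t, all (within (p + b) (q + b).-1) t
    & nu (predU W (mem t)) p q <= n].
Proof.
move=> le_nu room; move: p n le_nu room.
apply: (nu_ind (q := q)) => [p lt_qp|p le_pq IH1 IH2] n le_nu room.
  exists [::]; have -> : n = 0 by lia.
  by split => //; rewrite nu_empty.
have [n0|n_gt0] := posnP n.
  rewrite {}n0 in le_nu room *.
  by exists [::]; split => //; apply: leq_trans le_nu; apply: nu_le => i ->; rewrite /= orbF.
(* When exactly [2n] places remain, the pairs must tile them, so [p] is taken even if it is not in
   [W]. *)
have [take_p|skip_p] := boolP (W p || (q.+1 - p == n.*2)).
  have [||t [sz sp t_in nu_t]] := IH2 n.-1; [|by lia|].
    case/orP: take_p => [Wp|/eqP len]; first by move: le_nu; rewrite nuE // Wp; lia.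
    by have := nu_len W p.+2 q; lia.
  exists ((p + b) :: t); split => /=.
  - by lia.
  - rewrite sp andbT; apply: sub_all t_in => y; rewrite /within /spread; lia.
  - apply/andP; split; first by rewrite /within; lia.
    by apply: sub_all t_in => y; rewrite /within; lia.
  - apply: leq_trans (nu_split _ p p.+1 q) _.
    have -> : n = 1 + n.-1 by lia.
    apply: leq_add; first by set x := nu _ p p.+1; have: x.*2 <= p.+3 - p := nu_len _ _ _; lia.
    apply: leq_trans nu_t; apply: nu_le => i i_in; rewrite i_in /= !inE.
    by have -> : (i == p + b) = false by lia.
move: skip_p; rewrite negb_or => /andP[Wp len].
have [||t [sz sp t_in nu_t]] := IH1 n; [|by lia|].
  by move: le_nu; rewrite nuE // (negPf Wp).
exists t; split => //; first by apply: sub_all t_in => y; rewrite /within; lia.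
apply: leq_trans nu_t; apply: nu_le => i i_in.
rewrite /= => Wi; rewrite Wi andbT.
suff : i != p by lia.
apply: contraNneq Wp => eq_ip; move: Wi; rewrite eq_ip => /orP[//|/(allP t_in)].
by rewrite /within; lia.
Qed.

Lemma nu_splitN (W : pred nat) p i q : 0 < i -> ~~ W i ->
  nu W p q <= nu W p i.-1 + nu W i.+1 q.
Proof.
move=> i_gt0 Wi; apply: leq_trans (nu_split W p i.-1 q) _.
rewrite prednK // leq_add2l; apply: nu_le => j j_in Wj; rewrite Wj andbT.
by have : j != i by [apply: contraNneq Wi => <-]; lia.
Qed.

(** * Faces and the generators compatible with them *)

Definition spr (n p q : nat) (t : seq nat) : bool :=
  [&& size t == n, pairwise spread t & all (within p q) t].

Definition addset (W : pred nat) (t : seq nat) : pred nat := predU W (mem t).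

Lemma addset_sub (W : pred nat) t i : W i -> addset W t i.
Proof. by rewrite /addset /= => ->. Qed.

Lemma spr_in n p q t i : spr n p q t -> i \in t -> p <= i <= q.
Proof. by case/and3P => _ _ /allP H /H. Qed.

Lemma sprN n p q t i : spr n p q t -> ~~ (p <= i <= q) -> (i \in t) = false.
Proof. by move=> ht; apply: contraNF; apply: spr_in ht. Qed.

(* By [in_Igens] below, a monomial lies outside [I] iff its support is a face. *)
Definition face (a m : nat) (W : pred nat) : bool :=
  (nu W 2 m.-1 < a) && (W 1 && W m ==> (nu W 3 m.-2 < a.-1)).

Lemma face_sub (a m : nat) (W W' : pred nat) :
  0 < m -> (forall i, 1 <= i <= m -> W i -> W' i) -> face a m W' -> face a m W.
Proof.
move=> m_gt0 sub /andP[h1 h2]; apply/andP; split.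
  apply: leq_ltn_trans h1; apply: nu_le => i i_in Wi; rewrite i_in sub //; lia.
apply/implyP => /andP[W1 Wm].
have: nu W' 3 m.-2 < a.-1 by apply: (implyP h2); rewrite !sub //; lia.
apply: leq_ltn_trans; apply: nu_le => i i_in Wi; rewrite i_in sub //; lia.
Qed.

Lemma nu_witP (W : pred nat) p q n :
  reflect (exists2 t, spr n p q t & all W t) (n <= nu W p q).
Proof.
apply: (iffP idP) => [/nu_witn[t [sz sp t_in Wt]]|[t /and3P[/eqP <- sp t_in] Wt]].
  by exists t => //; rewrite /spr sz eqxx sp.
exact: nu_max.
Qed.

Lemma nu_widenl (W : pred nat) p q : nu W p q <= (nu W p.+1 q).+1.
Proof.
have [le_pq|lt_qp] := leqP p q; last by rewrite nu_empty.
rewrite nuE //; case: ifP => _; last exact: leqW.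
by rewrite ltnS; apply: nu_le => i i_in ->; rewrite andbT; lia.
Qed.

Lemma nu_widenr (W : pred nat) p q : nu W p q <= (nu W p q.-1).+1.
Proof.
apply: leq_trans (nu_split W p q.-1 q) _.
by have := nu_len W q.-1.+1 q; lia.
Qed.

Lemma nu_widenr_out (W : pred nat) p q : ~~ W q -> nu W p q <= nu W p q.-1.
Proof.
move=> Wq; apply: nu_le => i i_in Wi; rewrite Wi andbT.
by have : i != q by [apply: contraNneq Wq => <-]; lia.
Qed.

Lemma nu_addset_out (W : pred nat) t n r s p q :
  spr n r s t -> (q < r) || (s < p) -> nu (addset W t) p q = nu W p q.
Proof.
move=> ht out; apply: nu_eq => i i_in; rewrite /addset /= (sprN ht) ?orbF //; lia.
Qed.

Lemma nu_addset_cat (W : pred nat) t1 t2 p q :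
  nu (addset W (t1 ++ t2)) p q = nu (addset (addset W t1) t2) p q.
Proof. by apply: nu_eq => i _; rewrite /addset /= mem_cat orbA. Qed.

Lemma spr_cat n1 n2 p q r s t1 t2 : spr n1 p q t1 -> spr n2 r s t2 ->
  q.+2 <= r -> p <= r -> q <= s -> spr (n1 + n2) p s (t1 ++ t2).
Proof.
move=> ht1 ht2 qr pr qs; have /and3P[/eqP sz1 sp1 in1] := ht1.
have /and3P[/eqP sz2 sp2 in2] := ht2.
rewrite /spr size_cat sz1 sz2 eqxx pairwise_cat sp1 sp2 all_cat !andbT /=.
apply/and3P; split.
- apply/allrelP => x y /(spr_in ht1) + /(spr_in ht2); rewrite /spread; lia.
- by apply: sub_all in1 => x; rewrite /within; lia.
- by apply: sub_all in2 => x; rewrite /within; lia.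
Qed.

Lemma spr_widen n p q p' q' t : spr n p q t -> p' <= p -> q <= q' -> spr n p' q' t.
Proof.
case/and3P => sz sp t_in pp qq; rewrite /spr sz sp /=.
by apply: sub_all t_in => x; rewrite /within; lia.
Qed.

(** The strict inequality makes up for the unit lost in rounding when [l1] and [l2] are both odd. *)
Lemma room_split n1 n2 n l1 l2 :
  n1 + n2 <= n -> n1.*2 <= l1 -> n2.*2 <= l2 -> n.*2 < l1 + l2 ->
  exists k1 k2, [/\ k1 + k2 = n, n1 <= k1 <= l1./2 & n2 <= k2 <= l2./2].
Proof.
move=> h1 h2 h3 h4; exists (minn (n - n2) l1./2), (n - minn (n - n2) l1./2).
by split; lia.
Qed.

(** The pairs are laid out separately in [p, i-1] and [i+1, q]. Right ends before [i] and left ends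
    after [i] keep [t] away from [p] and [q] as well. *)
Lemma nu_extend_around (W : pred nat) p i q n : 0 < p -> ~~ W i ->
  nu W p i.-1 + nu W i.+1 q <= n -> (nu W p i.-1).*2 + p <= i ->
  (nu W i.+1 q).*2 + i <= q -> n.*2 + p < q ->
  exists t, [/\ i \notin t, spr n p.+1 q.-1 t & nu (addset W t) p q <= n].
Proof.
move=> p_gt0 Wi h1 h2 h3 h4.
have [|||k1 [k2 [kn /andP[k1a k1b] /andP[k2a k2b]]]] :=
  @room_split _ _ n (i - p) (q - i) h1; [lia|lia|lia|].
have [|t1 [/eqP sz1 sp1 in1 nu1]] := @nu_extend W true k1 p i.-1 k1a; first lia.
have [|t2 [/eqP sz2 sp2 in2 nu2]] := @nu_extend W false k2 i.+1 q k2a; first lia.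
have ht1 : spr k1 p.+1 i.-1 t1.
  by rewrite /spr sz1 sp1; apply: sub_all in1 => x; rewrite /within; lia.
have ht2 : spr k2 i.+1 q.-1 t2.
  by rewrite /spr sz2 sp2; apply: sub_all in2 => x; rewrite /within; lia.
have iN : i \notin t1 ++ t2 by rewrite mem_cat (sprN ht1) ?(sprN ht2) //; lia.
exists (t1 ++ t2); split=> //.
  by rewrite -kn; apply: spr_cat ht1 ht2 _ _ _; lia.
apply: leq_trans (@nu_splitN (addset W (t1 ++ t2)) p i q _ _) _; first lia.
  by rewrite /addset /= negb_or Wi.
rewrite -kn; apply: leq_add.
  by rewrite nu_addset_cat (nu_addset_out _ ht2) //; lia.
apply: leq_trans nu2; rewrite nu_addset_cat; apply: nu_le => x x_in.
rewrite /addset /= (sprN ht1) ?orbF; last by lia.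
by rewrite x_in.
Qed.

(** Here [n1], [n1'] are the counts to the left of [i] with and without the endpoint 2, and [n2],
    [n2'] those to the right with and without m-1. If [n1 + n2'] exceeds [a-2], then [n1 = n1' + 1],
    and [n1' + n2] is at most [a-2]. *)
Lemma face_avoid_arith n1 n1' n2 n2' i a m :
  n1' <= n1 <= n1'.+1 -> n2' <= n2 <= n2'.+1 ->
  n1.*2 < i -> n1'.*2.+1 < i -> n2.*2 + i <= m -> n2'.*2 + i < m ->
  n1 + n2 < a -> n1' + n2' < a.-1 -> a.*2 < m ->
  [&& n1 + n2' <= a.-2, n1.*2 + 2 <= i & n2'.*2 + i <= m.-2] ||
  [&& n1' + n2 <= a.-2, n1'.*2 + 3 <= i & n2.*2 + i <= m.-1].
Proof. lia. Qed.

Section Faces.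
Variables (a m : nat).
Hypotheses (a_ge3 : 3 <= a) (m_gt : a.*2 < m).

Lemma addset_id (W : pred nat) t : all W t -> face a m W -> face a m (addset W t).
Proof.
move=> /allP Wt; apply: face_sub => [|i _]; first by lia.
by case/orP => // /Wt.
Qed.

Lemma face_intro (W : pred nat) : nu W 2 m.-1 < a -> nu W 3 m.-2 < a.-1 -> face a m W.
Proof. by rewrite /face => -> ->; rewrite implybT. Qed.

(** If [W] contains [a-1] spread entries in [3, m-2], these serve. Otherwise it is enough to keep
    the count at most [a-2] on [2, m-2] or on [3, m-1], because one more endpoint raises it by at
    most one. *)
Lemma face_avoid (W : pred nat) i : face a m W -> 2 <= i <= m.-2 -> ~~ W i ->
  exists t, [/\ i \notin t, spr a.-1 2 m.-2 t \/ spr a.-2 3 (m - 3) t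
              & face a m (addset W t)].
Proof.
move=> faceW i_in Wi.
have [le_nu3|lt_nu3] := leqP a.-1 (nu W 3 m.-2).
  have /nu_witP[t ht Wt] := le_nu3.
  exists t; split; last exact: addset_id.
    by apply: contra Wi => /(allP Wt).
  by left; apply: spr_widen ht _ _; lia.
have /andP[lt_nu2 _] := faceW.
have g1 : nu W 2 i.-1 + nu W i.+1 m.-1 <= nu W 2 m.-1 by apply: nu_gap; lia.
have g2 : nu W 3 i.-1 + nu W i.+1 m.-2 <= nu W 3 m.-2 by apply: nu_gap; lia.
have e1 : nu W 3 i.-1 <= nu W 2 i.-1 by apply: nu_le => x x_in ->; lia.
have e2 : nu W i.+1 m.-2 <= nu W i.+1 m.-1 by apply: nu_le => x x_in ->; lia.
have w1 := nu_widenl W 2 i.-1; have w2 := nu_widenr W i.+1 m.-1.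
have l1 := nu_len W 2 i.-1; have l2 := nu_len W 3 i.-1.
have l3 := nu_len W i.+1 m.-1; have l4 := nu_len W i.+1 m.-2.
have /orP[/and3P[h1 h2 h3]|/and3P[h1 h2 h3]] :
    [&& nu W 2 i.-1 + nu W i.+1 m.-2 <= a.-2, (nu W 2 i.-1).*2 + 2 <= i
      & (nu W i.+1 m.-2).*2 + i <= m.-2]
 || [&& nu W 3 i.-1 + nu W i.+1 m.-1 <= a.-2, (nu W 3 i.-1).*2 + 3 <= i
      & (nu W i.+1 m.-1).*2 + i <= m.-1].
  by apply: face_avoid_arith; rewrite ?e1 ?e2 //; lia.
- have [|t [iN ht nu_t]] := @nu_extend_around W 2 i m.-2 a.-2 isT Wi h1 h2 h3; first lia.
  exists t; split=> //; first by right; apply: spr_widen ht _ _; lia.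
  apply: face_intro.
    by apply: leq_ltn_trans (nu_widenr _ _ _) _; lia.
  apply: (@leq_ltn_trans a.-2); last lia.
  by apply: leq_trans nu_t; apply: nu_le => x x_in ->; rewrite andbT; lia.
- have [|t [iN ht nu_t]] := @nu_extend_around W 3 i m.-1 a.-2 isT Wi h1 h2 h3; first lia.
  (* Adding 2 turns the [a-2] entries in [4, m-2] into a generator of the first kind and costs at
     most one on [2, m-1]. *)
  have h2t : spr 1 2 2 [:: 2] by [].
  have e x : 3 <= x -> addset W ([:: 2] ++ t) x = addset W t x.
    by move=> x_ge3; rewrite /addset /= inE; have -> : (x == 2) = false by lia.
  have nu3 q : nu (addset W ([:: 2] ++ t)) 3 q = nu (addset W t) 3 q.
    by apply: nu_eq => x x_in; rewrite e //; lia.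
  exists ([:: 2] ++ t); split.
  + by rewrite inE negb_or iN andbT; lia.
  + left; have -> : a.-1 = 1 + a.-2 by lia.
    by apply: spr_cat h2t ht _ _ _; lia.
  + apply: face_intro; first by apply: leq_ltn_trans (nu_widenl _ _ _) _; rewrite nu3; lia.
    rewrite nu3; apply: (@leq_ltn_trans a.-2); last lia.
    by apply: leq_trans nu_t; apply: nu_le => x x_in ->; rewrite andbT; lia.
Qed.

(** Without both 1 and m only the bound on [2, m-1] matters, and the left ends of its pairs stay in
    [2, m-2]. Otherwise m-1 is missing from [W]: the right ends of pairs in [3, m-2], together with
    2, keep the count on [2, m-1] below [a]. The lemma will force [psi(z_1 z_2 w)] to be divisible
    by [y]. *)
Lemma face_join (W : pred nat) : face a m W -> ~~ [&& W 1, W m.-1 & W m] ->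
  exists2 t, spr a.-1 2 m.-2 t & face a m (addset W t).
Proof.
move=> faceW notB; have /andP[lt_nu2 lt_nu3] := faceW.
have [W1m|W1m] := boolP (W 1 && W m); last first.
  have [||t [/eqP sz sp t_in nu_t]] := @nu_extend W false a.-1 2 m.-1; [lia|lia|].
  have ht : spr a.-1 2 m.-2 t.
    by rewrite /spr sz sp; apply: sub_all t_in => x; rewrite /within; lia.
  exists t => //; apply/andP; split; first by apply: leq_ltn_trans nu_t _; lia.
  by rewrite /addset /= !(sprN ht) ?orbF ?(negPf W1m) //; lia.
have {notB} Wm1 : ~~ W m.-1 by case/andP: W1m notB => -> ->; rewrite andbT.
rewrite W1m /= in lt_nu3.
have [||t [/eqP sz sp t_in nu_t]] := @nu_extend W true a.-2 3 m.-2; [lia|lia|].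
have ht : spr a.-2 4 m.-2 t.
  by rewrite /spr sz sp; apply: sub_all t_in => x; rewrite /within; lia.
have h2t : spr 1 2 2 [:: 2] by [].
have nu3 q : nu (addset W ([:: 2] ++ t)) 3 q = nu (addset W t) 3 q.
  apply: nu_eq => x x_in; rewrite /addset /= inE.
  by have -> : (x == 2) = false by lia.
exists ([:: 2] ++ t).
  have -> : a.-1 = 1 + a.-2 by lia.
  by apply: spr_cat h2t ht _ _ _; lia.
apply: face_intro; last by rewrite nu3; apply: leq_ltn_trans nu_t _; lia.
apply: leq_ltn_trans (nu_widenl _ _ _) _; rewrite nu3.
apply: (@leq_ltn_trans (nu (addset W t) 3 m.-2).+1).
  by rewrite ltnS; apply: nu_widenr_out; rewrite /addset /= negb_or Wm1 (sprN ht) //; lia.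
by apply: (@leq_ltn_trans a.-2.+1); [rewrite ltnS; exact: nu_t|lia].
Qed.

End Faces.

(** * Chains of jointly compatible generators *)

Definition run (x r : nat) : seq nat := [seq x + i.*2 | i <- iota 0 r].

Lemma runS x r : run x r.+1 = x :: run x.+2 r.
Proof.
rewrite /run /= addn0; congr cons; rewrite -[1]/(1 + 0) iotaDl -map_comp.
by apply: eq_map => i /=; lia.
Qed.

Lemma run_rcons x r : run x r.+1 = rcons (run x r) (x + r.*2).
Proof. by rewrite /run -addn1 iotaD map_cat cats1. Qed.

Lemma size_run x r : size (run x r) = r.
Proof. by rewrite size_map size_iota. Qed.

Lemma run_le x r y : y \in run x r.+1 -> x <= y <= x + r.*2.
Proof. by case/mapP => i; rewrite mem_iota => i_in ->; lia. Qed.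

(** The final block of entries exactly two apart is taken maximal, so its first entry [x0] can be
    lowered by one and remain spread from [s0]. *)
Lemma tight_suffix s x : pairwise spread (rcons s x) -> exists s0 x0 r,
  [/\ rcons s x = s0 ++ run x0 r.+1, x = x0 + r.*2 & all (fun y => y.+2 < x0) s0].
Proof.
elim/last_ind: s x => [|s z IHs] x sp.
  by exists [::], x, 0; rewrite /run /= addn0.
have /and3P[sz_x spz _] : [&& allrel spread (rcons s z) [:: x],
    pairwise spread (rcons s z) & pairwise spread [:: x]].
  by rewrite -pairwise_cat cats1.
have lt_zx : z.+2 <= x.
  by move/allrelP: sz_x => /(_ z x); rewrite mem_rcons !inE !eqxx; apply.
move: lt_zx; rewrite leq_eqVlt => /orP[/eqP eq_x|lt_zx].
  have [s0 [x0 [r [e1 e2 e3]]]] := IHs z spz.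
  exists s0, x0, r.+1; split=> //; last by lia.
  by rewrite run_rcons -rcons_cat -e1; have -> : x0 + r.+1.*2 = x by lia.
exists (rcons s z), x, 0; split; [by rewrite /run /= addn0 cats1|by lia|].
rewrite all_rcons lt_zx /=; apply/allP => y ys.
move: spz; rewrite -cats1 pairwise_cat => /andP[/allrelP/(_ y z ys)].
by rewrite inE eqxx => /(_ isT); rewrite /spread; lia.
Qed.

Lemma last_diff (t t' : seq nat) : size t = size t' -> t != t' ->
  exists s s' x x' q, [/\ t = rcons s x ++ q, t' = rcons s' x' ++ q,
                          size s = size s' & x != x'].
Proof.
elim/last_ind: t t' => [|t z IHt] t'; case/lastP: t' => [|t' z'] //;
  rewrite ?size_rcons //.
move=> /succn_inj eq_sz neq.
have [eq_z|neq_z] := eqVneq z z'; last first.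
  by exists t, t', z, z', [::]; rewrite !cats0.
have neq_t : t != t' by apply: contraNneq neq => ->; rewrite eq_z.
have [s [s' [x [x' [q [-> -> e1 e2]]]]]] := IHt _ eq_sz neq_t.
by exists s, s', x, x', (rcons q z); rewrite -!rcons_cat eq_z.
Qed.

(** A list of intervals, because a face containing 1 and m imposes the same bound on two overlapping
    intervals at once. *)
Definition nu_bounded (n : nat) (ivs : seq (nat * nat)) (W : pred nat) : bool :=
  all (fun iv => nu W iv.1 iv.2 <= n) ivs.

Lemma nu_bounded_sub n ivs (W W' : pred nat) : {subset W <= W'} ->
  nu_bounded n ivs W' -> nu_bounded n ivs W.
Proof.
move=> sub; apply: sub_all => iv; apply: leq_trans; apply: nu_le => i ->.
exact: sub.
Qed.

(* [t] and [t'] agree after their last difference [y < x]; the maximal tight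
   run of [t'] ending at [x] can be lowered at its first entry [x0], because a
   larger spread subset through [x0.-1] would have at most [size s0] entries
   before it (else [t'] is not extremal) and at least [size s0 + 1] (else [t]
   is not extremal). *)
Lemma spread_step n lo hi ivs (sigma : pred nat) t t' s s' x x' q :
  all (fun iv => (iv.1 <= lo) && (hi <= iv.2)) ivs ->
  spr n lo hi t -> spr n lo hi t' ->
  nu_bounded n ivs (addset sigma t) -> nu_bounded n ivs (addset sigma t') ->
  t = rcons s x ++ q -> t' = rcons s' x' ++ q -> size s = size s' -> x < x' ->
  exists u, [/\ spr n lo hi u, sumn u < sumn t'
              & nu_bounded n ivs (addset (addset sigma u) t')].
Proof.
move=> /allP ivs_ok ht ht' bt bt' def_t def_t' eq_sz lt_x.
have /and3P[/eqP sz_t sp_t in_t] := ht.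
have /and3P[/eqP sz_t' sp_t' in_t'] := ht'.
have [s0 [x0 [r [e1 e2 /allP e3]]]] : exists s0 x0 r,
  [/\ rcons s' x' = s0 ++ run x0 r.+1, x' = x0 + r.*2 & all (fun y => y.+2 < x0) s0].
  by apply: tight_suffix; move: sp_t'; rewrite def_t' pairwise_cat => /and3P[].
have sz_s : size s = size s0 + r.
  have := congr1 size e1; rewrite size_rcons size_cat size_run; lia.
have le_s y : y \in rcons s x -> lo <= y <= x.
  move=> ys; have -> /= : lo <= y.
    by move/allP/(_ y): in_t; rewrite def_t mem_cat ys => /(_ isT) /andP[].
  move: ys; rewrite mem_rcons inE => /orP[/eqP ->//|ys].
  move: sp_t; rewrite def_t -cats1 -catA pairwise_cat => /andP[/allrelP/(_ y x ys)].
  by rewrite mem_cat inE eqxx => /(_ isT); rewrite /spread; clear; lia.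
have sp_s : pairwise spread (rcons s x).
  by move: sp_t; rewrite def_t pairwise_cat => /and3P[].
(* Room for the lowering: [rcons s x] has [size s0 + r + 1] spread entries between [lo] and [x], and
   [x] is below [x0 + 2r]. *)
have lo_x0 : lo < x0.
  have s_in : all (within lo x) (rcons s x) by apply/allP => y /le_s.
  by have := spread_size sp_s s_in; rewrite size_rcons; move: lt_x e2 sz_s; clear; lia.
have t'E : t' = s0 ++ x0 :: (run x0.+2 r ++ q) by rewrite def_t' e1 runS -catA.
have sp0 : pairwise spread (x0 :: (run x0.+2 r ++ q)).
  by move: sp_t'; rewrite t'E pairwise_cat => /and3P[].
have q_gt y : y \in q -> x0 + r.*2 + 2 <= y.
  move=> yq; move: sp_t'; rewrite def_t' pairwise_cat => /andP[/allrelP/(_ x' y)].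
  by rewrite mem_rcons inE eqxx yq => /(_ isT isT); rewrite /spread; move: e2; clear; lia.
pose u := s0 ++ x0.-1 :: (run x0.+2 r ++ q).
have uE y : y \in u -> (y == x0.-1) || (y \in t').
  by rewrite /u t'E !mem_cat !inE => /or3P[->|->|->]; rewrite ?orbT.
exists u; split.
- apply/and3P; split.
  + by rewrite /u -sz_t' t'E !size_cat.
  + move: sp_t'; rewrite t'E /u !pairwise_cat !pairwise_cons => /and3P[h1 -> /andP[h2 ->]].
    rewrite andbT /=; apply/andP; split.
      apply/allrelP => y z ys0; rewrite inE => /orP[/eqP ->|zr].
        by have := e3 _ ys0; rewrite /spread; clear; lia.
      by move/allrelP: h1 => /(_ y z ys0); rewrite inE zr orbT; apply.
    by apply: sub_all h2 => y; rewrite /spread; clear; lia.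
  + apply/allP => y /uE /orP[/eqP ->|/(spr_in ht')] //.
    have := spr_in ht' (i := x0); rewrite t'E mem_cat inE eqxx orbT => /(_ isT).
    by rewrite /within; move: lo_x0; clear; lia.
- rewrite t'E /u !sumn_cat /=; move: lo_x0; clear; lia.
apply/allP => iv iv_in; have /andP[iv1 iv2] := ivs_ok _ iv_in.
have /andP[bti bti'] : (nu (addset sigma t) iv.1 iv.2 <= n) &&
                       (nu (addset sigma t') iv.1 iv.2 <= n).
  by rewrite (allP bt _ iv_in) (allP bt' _ iv_in).
rewrite leqNgt; apply/negP => /nu_witP[w hw Ww].
have /and3P[/eqP sz_w sp_w in_w] := hw.
have Wy y : y \in w -> y != x0.-1 -> addset sigma t' y.
  move=> /(allP Ww); rewrite /addset /= => /orP[/orP[->//|/uE]|->]; last by rewrite orbT.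
  by case/orP => [->//|->]; rewrite orbT.
have x0w : x0.-1 \in w.
  apply/negPn/negP => xN.
  have w_in : all (addset sigma t') w.
    by apply/allP => y yw; apply: Wy => //; apply: contraNneq xN => <-.
  by have := nu_max sp_w in_w w_in; rewrite sz_w ltnNge bti'.
have [w1 [w2 def_w]] : exists w1 w2 : seq nat, w = w1 ++ x0.-1 :: w2.
  by case/splitPr: x0w => w1 w2; exists w1, w2.
rewrite {}def_w in sz_w sp_w in_w Wy.
rewrite size_cat /= in sz_w.
have w1_lt y : y \in w1 -> y.+2 <= x0.-1.
  move=> yw; move: sp_w; rewrite pairwise_cat => /andP[/allrelP/(_ y x0.-1 yw)].
  by rewrite inE eqxx => /(_ isT).
have w2_gt y : y \in w2 -> x0.+1 <= y.
  move=> yw; move: sp_w; rewrite pairwise_cat => /and3P[_ _].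
  by rewrite pairwise_cons => /andP[/allP/(_ _ yw)]; rewrite /spread; clear; lia.
have [sp1 sp2] : pairwise spread w1 /\ pairwise spread w2.
  by move: sp_w; rewrite pairwise_cat pairwise_cons => /and3P[_ -> /andP[_ ->]].
have in_iv y : lo <= y <= hi -> within iv.1 iv.2 y.
  by case/andP => y1 y2; rewrite /within (leq_trans iv1 y1) (leq_trans y2 iv2).
have b1 : size w1 <= size s0.
  have : size (w1 ++ x0 :: (run x0.+2 r ++ q)) <= n.
    apply: leq_trans bti'; apply: nu_max.
    - rewrite pairwise_cat sp1 sp0 !andbT; apply/allrelP => y z /w1_lt y_lt.
      rewrite inE => /orP[/eqP ->|]; first by move: y_lt; rewrite /spread; clear; lia.
      move=> zr; move: sp0; rewrite pairwise_cons => /andP[/allP/(_ _ zr)].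
      by move: y_lt; rewrite /spread; clear; lia.
    - rewrite all_cat; apply/andP; split.
        by apply/allP => y yw; apply: (allP in_w); rewrite mem_cat yw.
      apply/allP => y yr; apply: in_iv; apply: (spr_in ht').
      by rewrite t'E mem_cat yr orbT.
    - rewrite all_cat; apply/andP; split.
        apply/allP => y yw; apply: Wy; first by rewrite mem_cat yw.
        by have := w1_lt _ yw; clear; lia.
      by apply/allP => y yr; rewrite /addset /= t'E mem_cat yr !orbT.
  by rewrite -sz_t' t'E !size_cat leq_add2r.
(* The entries of [w2] start at [x0 + 1] or later and are at least two apart. From index [r] on they
   exceed [x' = x0 + 2r], so they can follow [rcons s x]. *)
have drop_gt y : y \in drop r w2 -> x0 + r.*2 < y.
  move=> yd; have : pairwise spread (take r w2 ++ drop r w2) by rewrite cat_take_drop.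
  rewrite pairwise_cat => /and3P[/allrelP rel spt _].
  have sz_d : size (drop r w2) > 0 by case: (drop r w2) yd.
  have sz_tk : size (take r w2) = r.
    by rewrite size_takel //; move: sz_d; rewrite size_drop; clear; lia.
  have [|lt_y] := leqP r 0.
    by rewrite leqn0 => /eqP r0; have := w2_gt _ (mem_drop yd); rewrite r0; clear; lia.
  have tk_in : all (within x0.+1 (y - 2)) (take r w2).
    apply/allP => z zt; have := rel _ _ zt yd; have := w2_gt _ (mem_take zt).
    by rewrite /spread /within; clear; lia.
  have := spread_size spt tk_in; rewrite sz_tk.
  by have := w2_gt _ (mem_drop yd); move: lt_y; clear; lia.
(* As [size s = size s0 + r] and [size w1 <= size s0], this spread set has at least
   [size w1 + 1 + size w2 = n + 1] entries, a contradiction. *)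
have : size (rcons s x ++ drop r w2) <= n.
  apply: leq_trans bti; apply: nu_max.
  - rewrite pairwise_cat sp_s (subseq_pairwise (drop_subseq _ _) sp2) !andbT.
    by apply/allrelP => y z /le_s + /drop_gt; rewrite /spread; move: lt_x e2; clear; lia.
  - rewrite all_cat; apply/andP; split.
      by apply/allP => y ys; apply: in_iv; apply: (spr_in ht); rewrite def_t mem_cat ys.
    apply/allP => y /mem_drop yw; apply: (allP in_w).
    by rewrite mem_cat inE yw !orbT.
  - rewrite all_cat; apply/andP; split; apply/allP => y.
      by move=> ys; rewrite /addset /= def_t mem_cat ys !orbT.
    move=> yd; have y_gt := drop_gt _ yd.
    have : addset sigma t' y.
      apply: Wy; first by rewrite mem_cat inE (mem_drop yd) !orbT.
      by have := w2_gt _ (mem_drop yd); clear; lia.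
    rewrite /addset /= def_t def_t' e1 !mem_cat => /orP[->//|].
    case/orP => [/orP[/e3|/run_le]|->]; rewrite ?orbT //; move: y_gt; clear; lia.
rewrite size_cat size_rcons size_drop; move: b1 sz_s sz_w sz_t.
by rewrite def_t size_cat size_rcons; clear; lia.
Qed.

(** At the last difference, [spread_step] replaces the set with the larger entry by a lower one
    jointly bounded with it. The sum of all entries decreases, so the process ends with equal
    sets. *)
Lemma spread_chain n lo hi ivs (sigma : pred nat) (X : Type) (lam : seq nat -> X) :
  all (fun iv => (iv.1 <= lo) && (hi <= iv.2)) ivs ->
  (forall t t', spr n lo hi t -> spr n lo hi t' ->
     nu_bounded n ivs (addset (addset sigma t) t') -> lam t = lam t') ->
  forall t t', spr n lo hi t -> spr n lo hi t' ->
    nu_bounded n ivs (addset sigma t) -> nu_bounded n ivs (addset sigma t') ->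
    lam t = lam t'.
Proof.
move=> ivs_ok lam_eq t t'.
have [k] : exists k, sumn t + sumn t' < k by exists (sumn t + sumn t').+1.
elim: k t t' => // k IHk t t' le_k ht ht' bt bt'.
have [->//|neq_t] := eqVneq t t'.
have eq_sz : size t = size t'.
  by case/and3P: ht ht' => /eqP -> _ _ /and3P[/eqP ->].
have [s [s' [x [x' [q [e e' es]]]]]] := last_diff eq_sz neq_t.
have sub u v : nu_bounded n ivs (addset (addset sigma u) v) ->
  nu_bounded n ivs (addset sigma u).
  by apply: nu_bounded_sub => i i_in; apply: addset_sub.
rewrite neq_ltn => /orP[lt_x|lt_x].
- have [u [hu lt_u bu]] := spread_step ivs_ok ht ht' bt bt' e e' es lt_x.
  rewrite -(lam_eq _ _ hu ht' bu); apply: IHk => //; last exact: sub bu.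
  by move: lt_u le_k; clear; lia.
- have [u [hu lt_u bu]] := spread_step ivs_ok ht' ht bt' bt e' e (esym es) lt_x.
  rewrite -(lam_eq _ _ hu ht bu); apply: IHk => //; last exact: sub bu.
  by move: lt_u le_k; clear; lia.
Qed.

Section FaceChains.
Variables (a m : nat).
Hypotheses (a_ge3 : 3 <= a) (m_gt : a.*2 < m).

(** Unless [sigma] contains both 1 and m, only the bound on [2, m-1] counts. If it does, at most
    [a-2] spread entries fit in [3, m-2], so every compatible [t] starts with 2. Its tail moves in
    [4, m-2] under the bound [a-2] on [3, m-2] and on [4, m-1], the entry 2 using up one of the
    [a-1] allowed on [2, m-1]. *)
Lemma face_chain_v (sigma : pred nat) (X : Type) (lam : seq nat -> X) :
  (forall t t', spr a.-1 2 m.-2 t -> spr a.-1 2 m.-2 t' ->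
     face a m (addset (addset sigma t) t') -> lam t = lam t') ->
  forall t t', spr a.-1 2 m.-2 t -> spr a.-1 2 m.-2 t' ->
    face a m (addset sigma t) -> face a m (addset sigma t') -> lam t = lam t'.
Proof.
move=> lam_eq t t' ht ht' ft ft'.
have out u W : spr a.-1 2 m.-2 u -> (addset W u 1 = W 1) * (addset W u m = W m).
  by move=> hu; rewrite /addset /= !(sprN hu) ?orbF //; move: m_gt; clear; lia.
have [s1m|s1m] := boolP (sigma 1 && sigma m); last first.
  have faceE W u : ~~ (W 1 && W m) -> spr a.-1 2 m.-2 u ->
      face a m (addset W u) = nu_bounded a.-1 [:: (2, m.-1)] (addset W u).
    move=> W1m hu; rewrite /face /nu_bounded /= !(out u) // (negPf W1m) /= !andbT.
    by move: a_ge3; clear; lia.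
  apply: (@spread_chain a.-1 2 m.-2 [:: (2, m.-1)] sigma) => //; rewrite -?faceE //.
    by rewrite /= leq_pred.
  move=> u u' hu hu' b; apply: lam_eq => //; rewrite faceE //.
  by rewrite !(out u).
have headP u : spr a.-1 2 m.-2 u -> face a m (addset sigma u) ->
    exists2 u', u = 2 :: u' & spr a.-2 4 m.-2 u'.
  move=> hu /andP[_]; rewrite !(out u) // s1m /= => lt_nu.
  have /and3P[/eqP sz sp u_in] := hu.
  case: u hu sz sp u_in lt_nu => [|x u] hu sz sp u_in lt_nu.
    by move: sz a_ge3; clear => /=; lia.
  have sp' := sp; rewrite pairwise_cons in sp'; case/andP: sp' => /allP xu spu.
  have [x2|neq_x] := eqVneq x 2.
    exists u; rewrite ?x2 //; apply/and3P; split=> //.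
      by apply/eqP; move: sz => /=; clear; lia.
    apply/allP => y yu; have := xu _ yu; have := spr_in hu (i := y).
    rewrite inE yu orbT => /(_ isT); rewrite x2 /spread /within; clear; lia.
  have : size (x :: u) <= nu (addset sigma (x :: u)) 3 m.-2.
    apply: nu_max => //; last by apply/allP => y yu; rewrite /addset /= yu orbT.
    have x_ge : 3 <= x.
      by have := spr_in hu (mem_head _ _); move: neq_x; clear; lia.
    apply/allP => y yu; have := spr_in hu yu; move: yu; rewrite inE.
    case/orP => [/eqP ->|/xu]; move: x_ge; rewrite /spread /within; clear; lia.
  by rewrite sz leqNgt lt_nu.
have ivs_ok : all (fun iv : nat * nat => (iv.1 <= 4) && (m.-2 <= iv.2))
                  [:: (3, m.-2); (4, m.-1)].
  by move: m_gt; rewrite /=; clear; lia.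
pose ivs := [:: (3, m.-2); (4, m.-1)].
have m_gt0 : 0 < m by move: m_gt; clear; lia.
have faceE (W : pred nat) : W 1 -> W m -> W 2 -> face a m W = nu_bounded a.-2 ivs W.
  move=> W1 Wm W2; rewrite /face W1 Wm /= andbT nuE ?W2; last by move: a_ge3 m_gt; clear; lia.
  by move: a_ge3; clear; lia.
have [u def_t hu] := headP _ ht ft; have [u' def_t' hu'] := headP _ ht' ft'.
rewrite {}def_t {}def_t' in ht ht' ft ft' *.
have /andP[sig1 sigm] := s1m.
have eqW w : addset (addset sigma [:: 2]) w =1 addset sigma (2 :: w).
  by move=> i; rewrite /addset /= !inE orbA.
have bE w : nu_bounded a.-2 ivs (addset (addset sigma [:: 2]) w) =
            face a m (addset sigma (2 :: w)).
  rewrite (faceE (addset sigma (2 :: w))); last 3 first.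
  - by rewrite /addset /= sig1.
  - by rewrite /addset /= sigm.
  - by rewrite /addset /= inE eqxx orbT.
  rewrite /nu_bounded; apply: eq_all => iv.
  by rewrite (nu_eq (W' := addset sigma (2 :: w))) // => i _; apply: eqW.
apply: (@spread_chain a.-2 4 m.-2 ivs (addset sigma [:: 2]) X (fun w => lam (2 :: w))) => //;
  rewrite ?bE //.
move=> w w' hw hw' b.
have cons2 v : spr a.-2 4 m.-2 v -> spr a.-1 2 m.-2 (2 :: v).
  move=> hv; have -> : a.-1 = 1 + a.-2 by move: a_ge3; clear; lia.
  rewrite -cat1s; apply: (@spr_cat 1 a.-2 2 2 4 m.-2) hv _ _ _ => //.
  by move: a_ge3 m_gt; clear; lia.
apply: lam_eq; rewrite ?cons2 // faceE.
- apply: nu_bounded_sub b => i; rewrite /addset -!topredE /= !inE.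
  by case: (sigma i) (i == 2) (i \in w) (i \in w') => [] [] [] [].
- by rewrite /addset /= sig1.
- by rewrite /addset /= sigm.
- by rewrite /addset /= !inE eqxx !orbT.
Qed.

(** The vertex m-1 uses up one of the [a-1] entries allowed on [2, m-1], which leaves the bound
    [a-2] on [2, m-3] beside the one on [3, m-2]. *)
Lemma face_chain_w (sigma : pred nat) (X : Type) (lam : seq nat -> X) :
  sigma 1 -> sigma m.-1 -> sigma m ->
  (forall t t', spr a.-2 3 (m - 3) t -> spr a.-2 3 (m - 3) t' ->
     face a m (addset (addset sigma t) t') -> lam t = lam t') ->
  forall t t', spr a.-2 3 (m - 3) t -> spr a.-2 3 (m - 3) t' ->
    face a m (addset sigma t) -> face a m (addset sigma t') -> lam t = lam t'.
Proof.
move=> sig1 sigm1 sigm lam_eq t t' ht ht' ft ft'.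
pose ivs := [:: (3, m.-2); (2, m - 3)].
have ivs_ok : all (fun iv : nat * nat => (iv.1 <= 3) && (m - 3 <= iv.2)) ivs.
  by move: m_gt; rewrite /=; clear; lia.
have faceE (W : pred nat) : W 1 -> W m.-1 -> W m -> face a m W = nu_bounded a.-2 ivs W.
  move=> W1 Wm1 Wm; rewrite /face W1 Wm /= andbT andbC.
  have -> : nu W 2 m.-1 = (nu W 2 (m - 3)).+1; last by move: a_ge3; clear; lia.
  apply/eqP; rewrite eqn_leq; apply/andP; split.
    have := nu_split W 2 (m - 3) m.-1; have := nu_len W (m - 3).+1 m.-1.
    by move: m_gt a_ge3; clear; lia.
  have e : nu W m.-1 m.-1 = 1 by rewrite nuE // Wm1 nu_empty.
  rewrite -addn1 -[X in _ + X]e; apply: nu_gap; move: m_gt a_ge3; clear; lia.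
have sadd u v : addset (addset sigma u) v 1 && addset (addset sigma u) v m.-1 &&
                addset (addset sigma u) v m.
  by rewrite /addset /= sig1 sigm1 sigm.
apply: (@spread_chain a.-2 3 (m - 3) ivs sigma) => //; last 2 first.
- by rewrite -faceE //; apply: addset_sub.
- by rewrite -faceE //; apply: addset_sub.
move=> u v hu hv b; apply: lam_eq => //.
by rewrite faceE //; do 2!apply: addset_sub.
Qed.

End FaceChains.

(** * Monomial ideals *)

Local Open Scope ring_scope.

Section Ideals.
Variable T : comNzRingType.
Implicit Types (G : T -> Prop) (f g r : T).

Lemma in_ideal0 G : in_ideal G 0.
Proof. by exists [::]; rewrite big_nil. Qed.

Lemma in_ideal_gen G r g : G g -> in_ideal G (r * g).
Proof.
move=> Gg; exists [:: (r, g)]; split; last by rewrite big_seq1.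
by move=> q; rewrite inE => /eqP ->.
Qed.

Lemma in_idealD G f g : in_ideal G f -> in_ideal G g -> in_ideal G (f + g).
Proof.
move=> [s [Gs ->]] [s' [Gs' ->]]; exists (s ++ s'); rewrite big_cat; split=> //.
by move=> q; rewrite mem_cat => /orP[/Gs|/Gs'].
Qed.

Lemma in_ideal_ind G (P : T -> Prop) :
  P 0 -> (forall f g, P f -> P g -> P (f + g)) ->
  (forall r g, G g -> P (r * g)) -> forall f, in_ideal G f -> P f.
Proof.
move=> P0 PD PG f [s [Gs ->]]; elim: s Gs => [|q s IHs] Gs; first by rewrite big_nil.
rewrite big_cons; apply: PD; first by apply: PG; apply: Gs; rewrite mem_head.
by apply: IHs => q' q's; apply: Gs; rewrite inE q's orbT.
Qed.

Lemma in_idealM G r f : in_ideal G f -> in_ideal G (r * f).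
Proof.
elim/in_ideal_ind: f / => [|f g Gf Gg|r' g Gg].
- by rewrite mulr0; apply: in_ideal0.
- by rewrite mulrDr; apply: in_idealD.
- by rewrite mulrA; apply: in_ideal_gen.
Qed.

Lemma in_idealN G f : in_ideal G f -> in_ideal G (- f).
Proof. by move=> Gf; rewrite -mulN1r; apply: in_idealM. Qed.

Lemma in_idealB G f g : in_ideal G f -> in_ideal G g -> in_ideal G (f - g).
Proof. by move=> Gf Gg; apply/in_idealD/in_idealN. Qed.

Lemma in_ideal_sum G (I : eqType) (s : seq I) (F : I -> T) :
  (forall i, i \in s -> in_ideal G (F i)) -> in_ideal G (\sum_(i <- s) F i).
Proof.
move=> GF; rewrite big_seq; apply: (big_ind (in_ideal G)) => //.
  exact: in_ideal0.
by move=> f g; apply: in_idealD.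
Qed.

Lemma in_ideal_trans G G' : (forall g, G g -> in_ideal G' g) ->
  forall f, in_ideal G f -> in_ideal G' f.
Proof.
move=> sub f; elim/in_ideal_ind: f / => [|f g|r g /sub].
- exact: in_ideal0.
- exact: in_idealD.
- exact: in_idealM.
Qed.

Lemma in_ideal1 G g : G g -> in_ideal G g.
Proof. by move=> Gg; rewrite -[g]mul1r; apply: in_ideal_gen. Qed.

End Ideals.

Lemma in_ideal_morph (T T' : comNzRingType) (h : {rmorphism T -> T'})
    (G : T -> Prop) (G' : T' -> Prop) :
  (forall g, G g -> in_ideal G' (h g)) -> forall f, in_ideal G f -> in_ideal G' (h f).
Proof.
move=> sub f; elim/in_ideal_ind: f / => [|f g|r g /sub].
- by rewrite rmorph0; apply: in_ideal0.
- by rewrite rmorphD; apply: in_idealD.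
- by rewrite rmorphM; apply: in_idealM.
Qed.

Section Monomials.
Variables (k : fieldType) (n : nat).
Implicit Types (f g : {mpoly k[n]}) (mu nu d : 'X_{1..n}).

Lemma mcoeffXM d f mu : ('X_[d] * f)@_(d + mu) = f@_mu.
Proof. by rewrite mulrC mcoeffMX. Qed.

Lemma mcoeffXM_out d f mu : ~~ (d <= mu)%MM -> ('X_[d] * f)@_mu = 0.
Proof.
move=> out; apply: memN_msupp_eq0; apply: contra out.
rewrite mulrC (perm_mem (msuppMX _ _)) => /mapP[nu _ ->]; exact: lem_addr.
Qed.

Lemma in_mono_ideal (G : {mpoly k[n]} -> Prop) (D : 'X_{1..n} -> Prop) :
  (forall g, G g <-> exists2 d, D d & g = 'X_[d]) -> forall f,
  in_ideal G f <-> (forall mu, mu \in msupp f -> exists2 d, D d & (d <= mu)%MM).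
Proof.
move=> GD f; split.
  elim/in_ideal_ind: f / => [mu|f g IHf IHg mu|r g /GD[d Dd ->] mu].
  - by rewrite msupp0.
  - by move/msuppD_le; rewrite mem_cat => /orP[/IHf|/IHg].
  - rewrite (perm_mem (msuppMX _ _)) => /mapP[nu _ ->].
    by exists d => //; apply: lem_addr.
move=> Df; rewrite (mpolyE f); apply: in_ideal_sum => mu /Df[d Dd le_d].
rewrite -(submK le_d) mpolyXD scalerAl; apply: in_ideal_gen.
by apply/GD; exists d.
Qed.

End Monomials.

Section Support.
Variables (k : fieldType) (N : nat).
Local Notation ix i := (inord i.-1 : 'I_N.+1).

(** One numbering from 1 serves all three rings: [N] is m+1 for R, m+2 for R[T] and m for the
    Stanley-Reisner ring. *)
Definition xvar (i : nat) : {mpoly k[N.+1]} := 'X_(ix i).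

Definition mset (t : seq nat) : 'X_{1..N.+1} := (\sum_(i <- t) U_(ix i))%MM.

Definition msp (mu : 'X_{1..N.+1}) : pred nat := fun i => (0 < mu (ix i))%N.

Lemma prod_xvar t : \prod_(i <- t) xvar i = 'X_[mset t].
Proof. by rewrite /mset mprodXE. Qed.

Lemma mset_cons i t : mset (i :: t) = (U_(ix i) + mset t)%MM.
Proof. by rewrite /mset big_cons. Qed.

Lemma msetE t j : mset t j = count_mem j [seq ix i | i <- t].
Proof.
elim: t => [|i t IHt]; first by rewrite /mset big_nil mnm0E.
by rewrite mset_cons mnmDE mnm1E IHt.
Qed.

Lemma ix_inj i j : (0 < i <= N.+1)%N -> (0 < j <= N.+1)%N -> ix i = ix j -> i = j.
Proof.
move=> hi hj /(congr1 val); rewrite /= !inordK; lia.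
Qed.

Lemma mspD mu nu i : msp (mu + nu) i = msp mu i || msp nu i.
Proof. by rewrite /msp mnmDE addn_gt0. Qed.

Lemma msp_mset_uniq t i : {in t, forall j, (0 < j <= N.+1)%N} -> (0 < i <= N.+1)%N ->
  msp (mset t) i = (i \in t).
Proof.
move=> t_in i_in; rewrite /msp msetE -has_count has_pred1.
apply/mapP/idP => [[j jt eq_ij]|it]; last by exists i.
by rewrite (ix_inj i_in (t_in _ jt) eq_ij).
Qed.

Lemma msp_mset n p q t i : spr n p q t -> (0 < p)%N -> (q <= N.+1)%N ->
  (0 < i <= N.+1)%N -> msp (mset t) i = (i \in t).
Proof.
move=> ht p_gt0 q_le; apply: msp_mset_uniq => j /(spr_in ht).
by move: p_gt0 q_le; clear; lia.
Qed.

Lemma mspU i j : (0 < i <= N.+1)%N -> (0 < j <= N.+1)%N ->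
  msp U_(ix i) j = (i == j).
Proof.
move=> hi hj; rewrite /msp mnm1E lt0b; apply/eqP/eqP => [/ix_inj->|->] //.
Qed.

Lemma spread_uniq t : pairwise spread t -> uniq t.
Proof. by apply: pairwise_uniq => x; rewrite /spread; lia. Qed.

Lemma mset_le_uniq t (mu : 'X_{1..N.+1}) : uniq t ->
  (forall i, i \in t -> 0 < i <= N.+1)%N -> (mset t <= mu)%MM = all (msp mu) t.
Proof.
move=> ut t_in; apply/mnm_lepP/allP => [le_mu i it|mu_t j].
  apply: leq_trans (le_mu (ix i)); rewrite msetE -has_count has_pred1.
  by apply/mapP; exists i.
rewrite msetE count_uniq_mem; last first.
  by rewrite map_inj_in_uniq // => i i' /t_in hi /t_in hi'; apply: ix_inj.
by case: mapP => // -[i it ->]; apply: mu_t.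
Qed.

Lemma mset_le n p q t mu : spr n p q t -> (0 < p)%N -> (q <= N.+1)%N ->
  (mset t <= mu)%MM = all (msp mu) t.
Proof.
move=> ht p_gt0 q_le; have /and3P[_ sp _] := ht.
apply: mset_le_uniq => [|i /(spr_in ht)]; first exact: spread_uniq.
by move: p_gt0 q_le; clear; lia.
Qed.

Lemma mset_cat s t : mset (s ++ t) = (mset s + mset t)%MM.
Proof. by rewrite /mset big_cat. Qed.

Lemma IgenP n p q f :
  Igen xvar n p q f <-> exists2 d, (exists2 t, spr n p q t & d = mset t) & f = 'X_[d].
Proof.
split=> [[t [sz so t_in ->]]|[d [t /and3P[/eqP sz sp t_in] ->] ->]].
  exists (mset t); last exact: prod_xvar.
  by exists t => //; rewrite /spr sz eqxx -(sorted_pairwise spread_trans) so.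
exists t; split=> //; last by rewrite prod_xvar.
by rewrite (sorted_pairwise spread_trans).
Qed.

Lemma in_Igen n p q f : (0 < p)%N -> (q <= N.+1)%N ->
  in_ideal (Igen xvar n p q) f <->
  (forall mu, mu \in msupp f -> (n <= nu (msp mu) p q)%N).
Proof.
move=> p_gt0 q_le; rewrite (in_mono_ideal (IgenP n p q)).
split=> H mu /H => [[_ [t ht ->]]|].
  by rewrite (mset_le _ ht) // => mu_t; apply/nu_witP; exists t.
case/nu_witP => t ht mu_t; exists (mset t); first by exists t.
by rewrite (mset_le _ ht).
Qed.

Section IdealI.
Variables (a m : nat).
Hypotheses (m_gt0 : (0 < m)%N) (m_le : (m <= N.+1)%N).

Lemma IgensP f : Igens xvar a m f <-> exists2 d,
  (exists2 t, spr a 2 m.-1 t & d = mset t) \/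
  (exists2 t, spr a.-1 3 m.-2 t & d = (U_(ix 1) + U_(ix m) + mset t)%MM) & f = 'X_[d].
Proof.
split=> [[/IgenP[d hd ->]|[w [/IgenP[d [t ht ->] ->] ->]]]|[d [hd|[t ht ->]] ->]].
- by exists d => //; left.
- exists (U_(ix 1) + U_(ix m) + mset t)%MM; first by right; exists t.
  by rewrite !mpolyXD.
- by left; apply/IgenP; exists d.
- right; exists 'X_[mset t]; split; last by rewrite !mpolyXD.
  by apply/IgenP; exists (mset t) => //; exists t.
Qed.

Lemma nfaceP mu : (3 <= a)%N -> (a.*2 < m)%N -> ~~ face a m (msp mu) <-> exists2 d,
  (exists2 t, spr a 2 m.-1 t & d = mset t) \/
  (exists2 t, spr a.-1 3 m.-2 t & d = (U_(ix 1) + U_(ix m) + mset t)%MM) &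
  (d <= mu)%MM.
Proof.
move=> a_ge3 m_gt.
have ms t n p q : spr n p q t -> (0 < p)%N -> (q <= m)%N ->
    (mset t <= mu)%MM = all (msp mu) t.
  by move=> ht p_gt0 q_le; apply: mset_le ht _ _ => //; apply: leq_trans m_le.
rewrite /face negb_and -leqNgt negb_imply -leqNgt; split.
  case/orP => [/nu_witP[t ht mu_t]|/andP[/andP[mu1 mum] /nu_witP[t ht mu_t]]].
    exists (mset t); first by left; exists t.
    by rewrite (ms _ _ _ _ ht) //; lia.
  exists (U_(ix 1) + U_(ix m) + mset t)%MM; first by right; exists t.
  apply/mnm_lepP => j; rewrite !mnmDE !mnm1E.
  have : (mset t <= mu)%MM by rewrite (ms _ _ _ _ ht) //; lia.
  move/mnm_lepP/(_ j).
  have tN i : (0 < i <= m)%N -> ~~ (3 <= i <= m.-2)%N -> ix i = j -> mset t j = 0%N.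
    move=> i_in iN def_j; apply/eqP; rewrite -leqn0 leqNgt -def_j.
    have := @msp_mset _ _ _ _ i ht isT; rewrite /msp => ->; try lia.
    by rewrite (sprN ht).
  have [e1|n1] := eqVneq (ix 1) j.
    rewrite (tN 1%N) // addn0.
    have [em|nm] := eqVneq (ix m) j; last by rewrite -e1 => _; exact: mu1.
    by have := @ix_inj 1 m; rewrite e1 em => /(_ ltac:(lia) ltac:(lia) erefl); lia.
  have [em|nm] := eqVneq (ix m) j; last by [].
  rewrite (tN m) //; [|by lia|by lia].
  by rewrite -em => _; exact: mum.
case=> d [[t ht ->]|[t ht ->]].
  rewrite (ms _ _ _ _ ht) //; last lia.
  by move=> mu_t; apply/orP; left; apply/nu_witP; exists t.
move=> le_mu; apply/orP; right.
have le_t : (mset t <= mu)%MM by apply: lepm_trans le_mu; apply: lem_addl.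
have le_i i : i = 1%N \/ i = m -> msp mu i.
  move=> hi; apply: leq_trans (mnm_lepP le_mu (ix i)).
  by rewrite !mnmDE !mnm1E; case: hi => ->; rewrite eqxx //= addn1 addSn.
rewrite !le_i; [|by right|by left].
by apply/nu_witP; exists t => //; rewrite -(ms _ _ _ _ ht) //; lia.
Qed.

Lemma in_Igens f : (3 <= a)%N -> (a.*2 < m)%N ->
  in_ideal (Igens xvar a m) f <->
  (forall mu, mu \in msupp f -> ~~ face a m (msp mu)).
Proof.
move=> a_ge3 m_gt; rewrite (in_mono_ideal IgensP).
by split=> H mu /H /nfaceP; apply.
Qed.

End IdealI.
End Support.

(** * Homomorphisms from J to R/I *)

Section Colon.
Local Open Scope nat_scope.
Variables (a m : nat).
Hypotheses (a_ge3 : 3 <= a) (m_gt : a.*2 < m).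

(** This is the inclusion of [I] in the ideal of the [v]: dropping m-1 costs a spread set at most
    one entry. *)
Lemma nface_v (W : pred nat) : ~~ face a m W -> a.-1 <= nu W 2 m.-2.
Proof.
rewrite /face negb_and -leqNgt negb_imply -leqNgt => /orP[le_a|/andP[_ le_a]].
  by have := nu_widenr W 2 m.-1; move: le_a; clear; lia.
by apply: leq_trans le_a _; apply: nu_le => i i_in ->; move: i_in; clear; lia.
Qed.

(** For a face, the counts on [2, m-3] and [3, m-2] are both at most [a-2]. Cut the counts on
    [2, m-2] and [3, m-3] at some [i] outside [W] and exchange the right halves: their sum is at
    most that of the former two, hence at most [2a-4], against the assumed [2a-3]. If no such [i]
    exists, [W] is too full to be a face. *)
Lemma nface_colon (W : pred nat) : W 1 -> W m.-1 -> W m ->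
  a.-1 <= nu W 2 m.-2 -> a.-2 <= nu W 3 (m - 3) -> ~~ face a m W.
Proof.
move=> W1 Wm1 Wm le_v le_w; apply/negP => /andP[lt_nu2].
rewrite W1 Wm /= => lt_nu3.
have lt_nu2' : nu W 2 (m - 3) + 1 <= nu W 2 m.-1.
  have e : nu W m.-1 m.-1 = 1 by rewrite nuE // Wm1 nu_empty.
  rewrite -[X in _ + X <= _]e.
  by apply: nu_gap; move: m_gt a_ge3; clear; lia.
have [/allP W_all|/allPn[i]] := boolP (all W (iota 2 (m - 3))).
  have : m.-2.+1 - 3 <= (nu W 3 m.-2).*2.
    by apply: nu_full => i i_in; apply: W_all; rewrite mem_iota; move: i_in; clear; lia.
  by move: lt_nu3 m_gt; clear; lia.
rewrite mem_iota => i_in Wi.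
have i_gt0 : 0 < i by move: i_in; clear; lia.
have h1 := @nu_splitN W 2 i m.-2 i_gt0 Wi.
have h2 := @nu_splitN W 3 i (m - 3) i_gt0 Wi.
have h3 : nu W 2 i.-1 + nu W i.+1 (m - 3) <= nu W 2 (m - 3).
  by apply: nu_gap; move: i_in m_gt a_ge3; clear; lia.
have h4 : nu W 3 i.-1 + nu W i.+1 m.-2 <= nu W 3 m.-2.
  by apply: nu_gap; move: i_in m_gt a_ge3; clear; lia.
move: h1 h2 h3 h4 lt_nu2 lt_nu2' lt_nu3 le_v le_w a_ge3; clear; lia.
Qed.

Lemma eq_face (W W' : pred nat) : (forall i, 1 <= i <= m -> W i = W' i) ->
  face a m W = face a m W'.
Proof.
move=> eqW; have m_gt0 : 0 < m by move: m_gt; clear; lia.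
by apply/idP/idP; apply: face_sub => // i i_in; rewrite eqW.
Qed.

End Colon.

(** There are finitely many spread sets in [lo, hi]. The bound is what makes the common cofactor in
    [glue_family] a polynomial. *)
Lemma spr_bounded n lo hi (F : seq nat -> nat) :
  exists B, forall t, spr n lo hi t -> (F t <= B)%N.
Proof.
exists (\max_(t : n.-tuple 'I_hi.+1) F (map val t))%N => t ht.
have /and3P[sz _ _] := ht.
have szt : size [seq (inord i : 'I_hi.+1) | i <- t] == n by rewrite size_map.
have -> : t = map val (Tuple szt).
  rewrite /= -map_comp map_id_in // => i /(spr_in ht) i_in /=.
  by rewrite inordK //; move: i_in; clear; lia.
exact: leq_bigmax.
Qed.

Section HomSide.
Variables (k : fieldType) (a m N : nat).
Hypotheses (a_ge3 : (3 <= a)%N) (m_gt : (a.*2 < m)%N) (m_le : (m <= N.+1)%N).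
Local Notation R := {mpoly k[N.+1]}.
Local Notation x := (xvar k N).
Local Notation I := (in_ideal (Igens x a m)).
Local Notation fc mu := (face a m (msp mu)).

Let m_gt0 : (0 < m)%N. Proof. by move: m_gt; clear; lia. Qed.

Lemma idealI_coef (f : R) mu : I f -> fc mu -> f@_mu = 0.
Proof.
move=> /(in_Igens m_gt0 m_le f a_ge3 m_gt) If fmu; apply: memN_msupp_eq0.
by apply/negP => /If; rewrite fmu.
Qed.

Lemma idealI_intro (f : R) : (forall mu, fc mu -> f@_mu = 0) -> I f.
Proof.
move=> H; apply/(in_Igens m_gt0 m_le f a_ge3 m_gt) => mu; rewrite mcoeff_msupp.
by apply: contra => /H ->.
Qed.

Lemma face_mspD (d mu : 'X_{1..N.+1}) n p q (t : seq nat) :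
  (forall i, (1 <= i <= m)%N -> msp d i = (i \in t)) ->
  spr n p q t -> fc (d + mu) = face a m (addset (msp mu) t).
Proof.
move=> hd ht; apply: eq_face => // i i_in.
by rewrite mspD hd // /addset /= orbC.
Qed.

Lemma coef_colon (f f' : R) d d' mu : I ('X_[d'] * f - 'X_[d] * f') ->
  fc (d' + mu) -> ~~ (d <= d' + mu)%MM -> f@_mu = 0.
Proof.
move=> If fmu out; have := idealI_coef If fmu.
by rewrite mcoeffB mcoeffXM mcoeffXM_out // subr0.
Qed.

Lemma msp_mset_in n p q t i : spr n p q t -> (0 < p)%N -> (q <= m)%N ->
  (1 <= i <= m)%N -> msp (mset N t) i = (i \in t).
Proof.
move=> ht p_gt0 q_le i_in; apply: msp_mset ht _ _ _ => //.
  exact: leq_trans m_le.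
by case/andP: i_in => -> /leq_trans; apply.
Qed.

(* A family [u t] indexed by the spread sets [t], which behaves like the
   restriction of a homomorphism to the monomials [mset t] and whose
   coefficients on faces only occur above [e + mset t], is multiplication by
   a single polynomial: the coefficients are constant along chains. *)
Lemma glue_family n lo hi (e zeta : 'X_{1..N.+1}) (u : seq nat -> R) :
  (0 < lo)%N -> (hi <= m)%N ->
  (forall i, (1 <= i <= m)%N -> ~~ msp zeta i) ->
  (forall t mu, spr n lo hi t -> fc mu -> (u t)@_mu != 0 -> (e + mset N t <= mu)%MM) ->
  (forall t t', spr n lo hi t -> spr n lo hi t' ->
     I ('X_[zeta + mset N t'] * u t - 'X_[zeta + mset N t] * u t')) ->
  (forall (c : 'X_{1..N.+1}) (lam : seq nat -> k),
     (forall t t', spr n lo hi t -> spr n lo hi t' ->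
       face a m (addset (addset (msp (c + e)) t) t') -> lam t = lam t') ->
     forall t t', spr n lo hi t -> spr n lo hi t' ->
       face a m (addset (msp (c + e)) t) -> face a m (addset (msp (c + e)) t') ->
       lam t = lam t') ->
  exists beta : R, forall t, spr n lo hi t -> I (u t - beta * 'X_[e + mset N t]).
Proof.
move=> lo_gt0 hi_le zetaN u_supp u_lin chain.
have [B u_B] := spr_bounded n lo hi (fun t => msize (u t)).
have fcE t mu : spr n lo hi t -> fc (mset N t + mu) = face a m (addset (msp mu) t).
  by move=> ht; apply: (face_mspD _ _ ht) => i i_in; apply: msp_mset_in ht _ _ _.
have const c : exists b, forall t, spr n lo hi t -> fc (mset N t + (c + e)) ->
    (u t)@_(mset N t + (c + e)) = b.
  have [[t0 [ht0 ft0]]|none] := pselect (exists t0, spr n lo hi t0 /\ fc (mset N t0 + (c + e))).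
    exists (u t0)@_(mset N t0 + (c + e)) => t ht ft.
    apply: (chain c (fun t => (u t)@_(mset N t + (c + e)))) => //; rewrite -?fcE //.
    move=> t1 t2 ht1 ht2 f12.
    have mu_eq s s' : (zeta + mset N s + (mset N s' + (c + e)))%MM =
                      (zeta + (mset N s + mset N s') + (c + e))%MM by rewrite !addmA.
    have fmu : fc (zeta + mset N t2 + (mset N t1 + (c + e))).
      rewrite (eq_face m_gt (W' := addset (addset (msp (c + e)) t1) t2)) // => i i_in.
      rewrite !(mspD _ _ i) (negPf (zetaN _ i_in)) (msp_mset_in ht1) // (msp_mset_in ht2) //.
      rewrite /addset /= mspD.
      by case: (i \in t1) (i \in t2) (msp c i) (msp e i) => [] [] [] [].
    have := idealI_coef (u_lin _ _ ht1 ht2) fmu.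
    rewrite mcoeffB mcoeffXM mu_eq [X in (zeta + X)%MM]addmC -mu_eq mcoeffXM.
    by move/eqP; rewrite subr_eq0 => /eqP.
  by exists 0 => t ht ft; case: none; exists t.
have [b b_eq] := choice const.
(* [choice] gives a value for every exponent; those of degree at least [B] are cut off, where all
   the [u t] have zero coefficients anyway. *)
pose beta : R := \sum_(c : 'X_{1..N.+1 < B}) (if (mdeg c < B)%N then b c else 0) *: 'X_[c].
have beta_c c : (mdeg c < B)%N -> beta@_c = b c.
  by move=> lt_c; rewrite /beta (mcoeff_mpoly (fun c => if (mdeg c < B)%N then b c else 0)) // lt_c.
have beta_0 c : (B <= mdeg c)%N -> beta@_c = 0.
  move=> le_c; rewrite /beta raddf_sum /= big1 // => c' _.
  rewrite mcoeffZ mcoeffX; case: eqP => [eq_c|]; last by rewrite mulr0.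
  by have := bmdeg c'; rewrite ltnNge eq_c le_c.
exists beta => t ht; apply: idealI_intro => mu fmu.
have [le_mu|out] := boolP (e + mset N t <= mu)%MM; last first.
  rewrite mcoeffB [beta * _]mulrC mcoeffXM_out // subr0.
  by apply/eqP; apply: contraNT out; apply: u_supp.
set c := (mu - (e + mset N t))%MM.
have def_mu : mu = (e + mset N t + c)%MM by rewrite addmC submK.
have def_mu' : mu = (mset N t + (c + e))%MM.
  by rewrite def_mu addmC addmA [(c + e + _)%MM]addmC.
rewrite mcoeffB {2}def_mu mcoeffMX.
have [lt_c|le_c] := ltnP (mdeg c) B.
  by rewrite beta_c // {1}def_mu' b_eq ?subrr // -def_mu'.
rewrite beta_0 // subr0; apply: memN_msupp_eq0; apply: msize_mdeg_ge.
apply: leq_trans (u_B t ht) _; apply: leq_trans le_c _.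
by rewrite def_mu mdegD leq_addl.
Qed.

End HomSide.

Section Hom.
Variables (k : fieldType) (a m : nat).
Hypotheses (a_ge3 : (3 <= a)%N) (m_gt : (a.*2 < m)%N).
Local Notation N := m.+1.
Local Notation R := {mpoly k[m.+2]}.
Local Notation I := (in_ideal (Igens (xR k m) a m)).
Local Notation J := (in_ideal (Jgens (xR k m) (z1R k m) (z2R k m) a m)).
Local Notation phi := (phi_rel (xR k m) (z1R k m) (z2R k m) a m).
Local Notation fc mu := (face a m (msp mu)).

Let m_gt0 : (0 < m)%N. Proof. by move: m_gt; clear; lia. Qed.
Let m_le : (m <= N.+1)%N. Proof. by clear; lia. Qed.

Let ey : 'X_{1..m.+2} := mset N [:: 1; m.-1; m]%N.
Let ez : 'X_{1..m.+2} := (U_(inord m) + U_(inord m.+1))%MM.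

Let prod_y : xR k m 1 * xR k m m.-1 * xR k m m = 'X_[ey].
Proof. by rewrite -prod_xvar !big_cons big_nil mulr1 mulrA. Qed.

Let prod_z : z1R k m * z2R k m = 'X_[ez].
Proof. by rewrite /ez mpolyXD. Qed.

Let ez_out i : (1 <= i <= m)%N -> ~~ msp ez i.
Proof.
move=> i_in; rewrite /msp /ez mnmDE !mnm1E addn_gt0 !lt0b negb_or.
by apply/andP; split; apply/negP => /eqP/(congr1 val);
  rewrite /= !inordK; move: i_in; clear; lia.
Qed.

Let ey_in i : i \in [:: 1; m.-1; m]%N -> msp ey i.
Proof.
by move=> i_in; rewrite /msp msetE -has_count has_pred1; apply/mapP; exists i.
Qed.

Lemma idealI_sub_v (f : R) : I f -> in_ideal (Igen (xR k m) a.-1 2 m.-2) f.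
Proof.
move=> /(in_Igens m_gt0 m_le f a_ge3 m_gt) If.
apply/(@in_Igen k N a.-1 2 m.-2) => // [|mu /If]; first by clear; lia.
exact: nface_v.
Qed.

Lemma idealI_sub_J (f : R) : I f -> J f.
Proof.
move=> /idealI_sub_v; apply: in_ideal_trans => g hg.
by apply: in_ideal1; left.
Qed.

(** Two representations of [u] put [z_1 z_2 (Q - Q')] in the ideal [A] of the [v], whose generators
    do not involve [z_1], [z_2]. Every monomial of [Q - Q'] thus lies in [A] and in the ideal [K] of
    the [w], and [nface_colon] puts its product with [y] in [I]. *)
Lemma phi_rel_welldef (u p p' : R) : phi u p -> phi u p' -> I (p - p').
Proof.
move=> [rs [ss [io [hrs hss Iio -> ->]]]] [rs' [ss' [io' [hrs' hss' Iio' + ->]]]].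
pose A := in_ideal (Igen (xR k m) a.-1 2 m.-2).
pose K := in_ideal (Igen (xR k m) a.-2 3 (m - 3)).
have zE (s : seq (R * R)) : \sum_(q <- s) q.1 * (z1R k m * z2R k m * q.2) =
    'X_[ez] * \sum_(q <- s) q.1 * q.2.
  by rewrite prod_z mulr_sumr; apply: eq_bigr => q _; rewrite mulrCA.
have yE (s : seq (R * R)) :
    \sum_(q <- s) q.1 * (xR k m 1 * xR k m m.-1 * xR k m m * q.2) =
    'X_[ey] * \sum_(q <- s) q.1 * q.2.
  by rewrite prod_y mulr_sumr; apply: eq_bigr => q _; rewrite mulrCA.
rewrite !zE !yE.
have Ars : A (\sum_(q <- rs) q.1 * q.2).
  by apply: in_ideal_sum => q /hrs; apply: in_ideal_gen.
have Ars' : A (\sum_(q <- rs') q.1 * q.2).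
  by apply: in_ideal_sum => q /hrs'; apply: in_ideal_gen.
have Kss : K (\sum_(q <- ss) q.1 * q.2).
  by apply: in_ideal_sum => q /hss; apply: in_ideal_gen.
have Kss' : K (\sum_(q <- ss') q.1 * q.2).
  by apply: in_ideal_sum => q /hss'; apply: in_ideal_gen.
move: Ars Ars' Kss Kss'.
set X := \sum_(q <- rs) _; set X' := \sum_(q <- rs') _.
set Q := \sum_(q <- ss) _; set Q' := \sum_(q <- ss') _.
move=> AX AX' KQ KQ' eq_u.
have AzQ : A ('X_[ez] * (Q - Q')).
  have -> : 'X_[ez] * (Q - Q') = X' - X + (io' - io).
    have : X' + 'X_[ez] * Q' + io' - (X + 'X_[ez] * Q + io) = 0.
      by rewrite eq_u subrr.
    by move=> h; apply/eqP; rewrite -subr_eq0 -[X in _ == X]oppr0 -h; apply/eqP; ring.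
  by apply: in_idealD; apply: in_idealB => //; apply: idealI_sub_v.
rewrite -mulrBr; have KB : K (Q - Q') by apply: in_idealB.
apply: (idealI_intro a_ge3 m_gt m_le) => mu fmu.
have [le_mu|out] := boolP (ey <= mu)%MM; last by rewrite mcoeffXM_out.
rewrite -(submK le_mu) addmC mcoeffXM; apply: memN_msupp_eq0.
set mu' := (mu - ey)%MM; apply/negP => mu_in; move: fmu; apply/negP.
rewrite -(submK le_mu) -/mu'.
have sub lo hi : (nu (msp mu') lo hi <= nu (msp (mu' + ey)) lo hi)%N.
  by apply: nu_le => i -> mui; rewrite mspD mui.
apply: nface_colon => //; rewrite ?mspD ?ey_in ?orbT ?inE ?eqxx ?orbT //.
- apply: leq_trans (sub _ _).
  have -> : nu (msp mu') 2 m.-2 = nu (msp (ez + mu')) 2 m.-2.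
    apply: nu_eq => i i_in; rewrite mspD (negPf (ez_out _)) //.
    by move: i_in; clear; lia.
  move/(@in_Igen k N a.-1 2 m.-2 _ isT ltac:(clear; lia)): AzQ; apply.
  by rewrite mcoeff_msupp mcoeffXM -mcoeff_msupp.
- apply: leq_trans (sub _ _).
  by move/(@in_Igen k N a.-2 3 (m - 3) _ isT ltac:(clear; lia)): KB; apply.
Qed.

Section Psi.
Variable psi : R -> R.
Hypothesis psi_lin : forall r u v, J u -> J v -> I (psi (r * u + v) - (r * psi u + psi v)).
Hypothesis psi_I : forall u, I u -> I (psi u).

Lemma psi_scale r u : J u -> I (psi (r * u) - r * psi u).
Proof.
move=> Ju; have J0 : J 0 by apply: in_ideal0.
have I0 : I (psi 0) by apply: psi_I; apply: in_ideal0.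
have := in_idealD (psi_lin r Ju J0) I0.
by rewrite addr0 opprD addrA subrK.
Qed.

Lemma psi_comm u v : J u -> J v -> I (v * psi u - u * psi v).
Proof.
move=> Ju Jv.
have := in_idealB (psi_scale u Jv) (psi_scale v Ju).
rewrite [v * u]mulrC.
have -> : psi (u * v) - u * psi v - (psi (u * v) - v * psi u) = v * psi u - u * psi v.
  by ring.
by [].
Qed.

End Psi.

Let J_v t : spr a.-1 2 m.-2 t -> J 'X_[mset N t].
Proof.
move=> ht; apply: in_ideal1; left; apply/IgenP.
by exists (mset N t) => //; exists t.
Qed.

Let J_w t : spr a.-2 3 (m - 3) t -> J 'X_[ez + mset N t].
Proof.
move=> ht; apply: in_ideal1; right; exists 'X_[mset N t]; split.
  by apply/IgenP; exists (mset N t) => //; exists t.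
by rewrite prod_z mpolyXD.
Qed.

Let fc_v t mu : spr a.-1 2 m.-2 t -> fc (mset N t + mu) = face a m (addset (msp mu) t).
Proof.
move=> ht; apply: (face_mspD m_gt _ _ ht) => i i_in.
by apply: (msp_mset_in m_le ht) => //; clear; lia.
Qed.

Let fc_w t mu : spr a.-2 3 (m - 3) t ->
  fc (ez + mset N t + mu) = face a m (addset (msp mu) t).
Proof.
move=> ht; apply: (face_mspD m_gt _ _ ht) => i i_in.
rewrite mspD (negPf (ez_out i_in)).
by apply: (msp_mset_in m_le ht) => //; clear; lia.
Qed.

Let mset_out n p q t i (d mu : 'X_{1..m.+2}) : spr n p q t -> (0 < p)%N -> (q <= m)%N ->
  i \in t -> ~~ msp d i -> ~~ msp mu i -> ~~ (mset N t <= d + mu)%MM.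
Proof.
move=> ht p_gt0 q_le it di mui; rewrite (mset_le _ ht) //; last by move: q_le; clear; lia.
apply/negP => /allP/(_ _ it); rewrite mspD.
by rewrite (negPf di) (negPf mui).
Qed.

Let msp_v n p q t i : spr n p q t -> (0 < p)%N -> (q <= m)%N -> (1 <= i <= m)%N ->
  i \notin t -> ~~ msp (mset N t) i.
Proof. by move=> ht p_gt0 q_le i_in; rewrite (msp_mset_in m_le ht). Qed.

Lemma hom_alpha (psi : R -> R) :
  (forall r u v, J u -> J v -> I (psi (r * u + v) - (r * psi u + psi v))) ->
  (forall u, I u -> I (psi u)) ->
  exists alpha : R, forall t, spr a.-1 2 m.-2 t ->
    I (psi 'X_[mset N t] - alpha * 'X_[mset N t]).
Proof.
move=> psi_lin psi_I.
have comm := psi_comm psi_lin psi_I.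
have [|||||alpha h] := @glue_family k a m N a_ge3 m_gt m_le a.-1 2 m.-2 0%MM 0%MM
  (fun t => psi 'X_[mset N t]) isT.
- by clear; lia.
- by move=> i _; rewrite /msp mnm0E.
- move=> t mu ht fmu nz; rewrite add0m (mset_le _ ht) //; last by clear; lia.
  apply/allPn => -[i it mui]; move: nz; apply/negP; rewrite negbK; apply/eqP.
  have i_in := spr_in ht it.
  have i_in' : (1 <= i <= m)%N by move: i_in; clear; lia.
  have [t' [it' [ht'|ht'] ft']] := face_avoid a_ge3 m_gt fmu i_in mui.
    apply: (coef_colon a_ge3 m_gt m_le (comm _ _ (J_v ht) (J_v ht'))).
      by rewrite fc_v.
    apply: (mset_out ht _ _ it) => //; first by clear; lia.
    by apply: (msp_v ht') => //; clear; lia.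
  apply: (coef_colon a_ge3 m_gt m_le (comm _ _ (J_v ht) (J_w ht'))).
    by rewrite fc_w.
  apply: (mset_out ht _ _ it) => //; first by clear; lia.
  rewrite mspD negb_or ez_out //.
  by apply: (msp_v ht') => //; clear; lia.
- by move=> t t' ht ht'; rewrite !add0m; apply: comm; apply: J_v.
- by move=> c lam; apply: face_chain_v.
by exists alpha => t /h; rewrite add0m.
Qed.

Lemma hom_beta (psi : R -> R) :
  (forall r u v, J u -> J v -> I (psi (r * u + v) - (r * psi u + psi v))) ->
  (forall u, I u -> I (psi u)) ->
  (forall t, spr a.-1 2 m.-2 t -> I (psi 'X_[mset N t])) ->
  exists beta : R, forall t, spr a.-2 3 (m - 3) t ->
    I (psi 'X_[ez + mset N t] - beta * 'X_[ey + mset N t]).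
Proof.
move=> psi_lin psi_I psi_v.
have comm := psi_comm psi_lin psi_I.
(* Since [psi] kills [v], the product [v psi(z_1 z_2 w)] lies in [I], so [psi(z_1 z_2 w)] has
   coefficient zero at every face compatible with [v]. *)
have kill t t' mu : spr a.-2 3 (m - 3) t -> spr a.-1 2 m.-2 t' ->
    face a m (addset (msp mu) t') -> (psi 'X_[ez + mset N t])@_mu = 0.
  move=> ht ht' ft'.
  have Iu : I ('X_[mset N t'] * psi 'X_[ez + mset N t]).
    have := in_idealD (comm _ _ (J_w ht) (J_v ht')) (in_idealM 'X_[ez + mset N t] (psi_v _ ht')).
    by rewrite subrK.
  have := @idealI_coef k a m N a_ge3 m_gt m_le _ (mset N t' + mu)%MM Iu.
  by rewrite fc_v // ft' mcoeffXM => ->.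
apply: (@glue_family k a m N a_ge3 m_gt m_le a.-2 3 (m - 3) ey ez
  (fun t => psi 'X_[ez + mset N t]) isT) => //.
- by clear; lia.
- move=> t mu ht fmu nz.
  (* By [face_join] every face that is not divisible by [y] is compatible with some [v]. *)
  have [yb|] := boolP [&& msp mu 1, msp mu m.-1 & msp mu m]; last first.
    case/(face_join a_ge3 m_gt fmu) => t' ht' ft'.
    by move: nz; rewrite (kill t t') ?eqxx.
  rewrite -mset_cat mset_le_uniq.
  + rewrite all_cat /= andbT yb; apply/allPn => -[i it mui].
    move: nz; apply/negP; rewrite negbK; apply/eqP.
    have i_in := spr_in ht it.
    have i_in' : (1 <= i <= m)%N by move: i_in; clear; lia.
    have [|t' [it' [ht'|ht'] ft']] := face_avoid a_ge3 m_gt fmu (_ : 2 <= i <= m.-2)%N mui.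
    * by move: i_in; clear; lia.
    * exact: kill ft'.
    apply: (coef_colon a_ge3 m_gt m_le (comm _ _ (J_w ht) (J_w ht'))).
      by rewrite fc_w.
    apply/negP => le_mu.
    have : (mset N t <= ez + mset N t' + mu)%MM.
      by apply: lepm_trans le_mu; apply: lem_addl.
    apply/negP; apply: (mset_out ht _ _ it) => //; first by clear; lia.
    rewrite mspD negb_or ez_out //.
    by apply: (msp_v ht') => //; clear; lia.
  + rewrite cat_uniq; have /and3P[_ /spread_uniq -> _] := ht; rewrite andbT.
    apply/andP; split; first by rewrite /= !inE; move: m_gt a_ge3; clear; lia.
    apply/hasPn => i /(spr_in ht) i_in; rewrite /= !inE; move: i_in m_gt a_ge3; clear; lia.
  + move=> i; rewrite mem_cat => /orP[|/(spr_in ht) i_in]; last by move: i_in; clear; lia.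
    by rewrite !inE; move: m_gt a_ge3; clear; lia.
- by move=> t t' ht ht'; apply: comm; apply: J_w.
- move=> c lam; apply: face_chain_w => //; by rewrite mspD ey_in ?orbT // !inE eqxx ?orbT.
Qed.

Lemma hom_generated (psi : R -> R) :
  (forall r u v, J u -> J v -> I (psi (r * u + v) - (r * psi u + psi v))) ->
  (forall u, I u -> I (psi u)) ->
  exists alpha beta : R, forall u p, phi u p -> I (psi u - (alpha * u + beta * p)).
Proof.
move=> psi_lin psi_I.
have [alpha h_alpha] := hom_alpha psi_lin psi_I.
have [|||beta h_beta] := @hom_beta (fun u => psi u - alpha * u).
- move=> r u v Ju Jv; have := psi_lin r u v Ju Jv.
  suff -> : psi (r * u + v) - (r * psi u + psi v) =
    psi (r * u + v) - alpha * (r * u + v) - (r * (psi u - alpha * u) + (psi v - alpha * v)).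
    by [].
  by ring.
- by move=> u Iu; apply: in_idealB; [exact: psi_I|exact: in_idealM].
- exact: h_alpha.
exists alpha, beta.
(* [phi] is given by finite sums, so the formula is carried through them by induction, as a property
   stable under linear combinations. *)
pose E u p := J u /\ I (psi u - (alpha * u + beta * p)).
have EM r g q u p : E g q -> E u p -> E (r * g + u) (r * q + p).
  move=> [Jg Ig] [Ju Iu]; split; first by apply: in_idealD => //; apply: in_idealM.
  have := in_idealD (psi_lin r g u Jg Ju) (in_idealD (in_idealM r Ig) Iu).
  suff -> : psi (r * g + u) - (r * psi g + psi u) +
    (r * (psi g - (alpha * g + beta * q)) + (psi u - (alpha * u + beta * p))) =
    psi (r * g + u) - (alpha * (r * g + u) + beta * (r * q + p)) by [].
  by ring.
have Ev g : Igen (xR k m) a.-1 2 m.-2 g -> E g 0.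
  case/IgenP => d [t ht ->] ->; split; first exact: J_v.
  by rewrite mulr0 addr0; apply: h_alpha.
have Ew g : Igen (xR k m) a.-2 3 (m - 3) g ->
    E (z1R k m * z2R k m * g) (xR k m 1 * xR k m m.-1 * xR k m m * g).
  case/IgenP => d [t ht ->] ->; rewrite prod_z prod_y -!mpolyXD; split; first exact: J_w.
  by rewrite opprD addrA; apply: h_beta.
move=> u p [rs [ss [io [hrs hss Iio -> ->]]]].
suff [] : E (\sum_(q <- rs) q.1 * q.2 +
      \sum_(q <- ss) q.1 * (z1R k m * z2R k m * q.2) + io)
    (\sum_(q <- ss) q.1 * (xR k m 1 * xR k m m.-1 * xR k m m * q.2)) by [].
elim: rs hrs => [|q rs IHrs] hrs; last first.
  rewrite big_cons -!addrA -[X in E _ X]add0r -[X in E _ (X + _)](mulr0 q.1).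
  apply: EM; first by apply: Ev; apply: hrs; rewrite mem_head.
  by rewrite addrA; apply: IHrs => q' hq'; apply: hrs; rewrite inE hq' orbT.
rewrite big_nil add0r {hrs}.
elim: ss hss => [|q ss IHss] hss.
  rewrite !big_nil add0r; split; first exact: idealI_sub_J.
  by rewrite mulr0 addr0; apply: in_idealB; [exact: psi_I|exact: in_idealM].
rewrite !big_cons -!addrA; apply: EM; first by apply: Ew; apply: hss; rewrite mem_head.
by apply: IHss => q' hq'; apply: hss; rewrite inE hq' orbT.
Qed.

End Hom.

(** * The unprojection ideal *)

Section LinearExtension.
Variables (k : fieldType) (n : nat) (V : lmodType k) (F : 'X_{1..n} -> V).

Definition lin_ext (f : {mpoly k[n]}) : V := \sum_(mu <- msupp f) f@_mu *: F mu.

Lemma lin_extE f (s : seq 'X_{1..n}) : uniq s -> {subset msupp f <= s} ->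
  lin_ext f = \sum_(mu <- s) f@_mu *: F mu.
Proof.
move=> us sub; rewrite (bigID (mem (msupp f))) /= [X in _ + X]big1 ?addr0.
  rewrite -big_filter; apply: perm_big; apply: uniq_perm; rewrite ?filter_uniq ?msupp_uniq //.
  by move=> mu; rewrite mem_filter; case: (boolP (mu \in msupp f)) => // /sub ->.
by move=> mu /memN_msupp_eq0 ->; rewrite scale0r.
Qed.

Lemma lin_extD f g : lin_ext (f + g) = lin_ext f + lin_ext g.
Proof.
pose s := undup (msupp f ++ msupp g); have us : uniq s by apply: undup_uniq.
have sub h : {subset msupp h <= msupp f ++ msupp g} -> {subset msupp h <= s}.
  by move=> hs mu /hs; rewrite mem_undup.
have sf : {subset msupp f <= s} by apply: sub => mu h; rewrite mem_cat h.
have sg : {subset msupp g <= s} by apply: sub => mu h; rewrite mem_cat h orbT.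
have sfg : {subset msupp (f + g) <= s} by apply: sub; apply: msuppD_le.
rewrite (lin_extE us sf) (lin_extE us sg) (lin_extE us sfg) -big_split /=.
by apply: eq_bigr => mu _; rewrite mcoeffD scalerDl.
Qed.

Lemma lin_ext0 : lin_ext 0 = 0.
Proof. by rewrite /lin_ext msupp0 big_nil. Qed.

Lemma lin_extZ c f : lin_ext (c *: f) = c *: lin_ext f.
Proof.
rewrite (lin_extE (msupp_uniq f) (@msuppZ_le _ _ c f)) /lin_ext scaler_sumr.
by apply: eq_bigr => mu _; rewrite mcoeffZ scalerA.
Qed.

Lemma lin_extN f : lin_ext (- f) = - lin_ext f.
Proof. by rewrite -[in LHS]scaleN1r lin_extZ scaleN1r. Qed.

Lemma lin_extX mu : lin_ext 'X_[mu] = F mu.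
Proof. by rewrite /lin_ext msuppX big_seq1 mcoeffX eqxx scale1r. Qed.

Lemma lin_ext_sum (T : Type) (s : seq T) (G : T -> {mpoly k[n]}) :
  lin_ext (\sum_(i <- s) G i) = \sum_(i <- s) lin_ext (G i).
Proof. exact: (big_morph lin_ext lin_extD lin_ext0). Qed.

Lemma lin_extM_eq0 g : (forall mu, lin_ext ('X_[mu] * g) = 0) ->
  forall r, lin_ext (r * g) = 0.
Proof.
move=> h r; rewrite (mpolyE r) mulr_suml lin_ext_sum big1 // => mu _.
by rewrite -scalerAl lin_extZ h scaler0.
Qed.

End LinearExtension.

(** In the presence of [w] a whole power of [y] can be traded for the same power of [T z_1 z_2] at
    once; [nf_congr] uses it with exponent [emin]. *)
Lemma subXX_ideal (T : comNzRingType) (G : T -> Prop) (x y w : T) e :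
  G ((x - y) * w) -> in_ideal G ((y ^+ e - x ^+ e) * w).
Proof.
move=> Gxy; rewrite subrXX -[y - x]opprB !mulNr mulrAC [_ * w * _]mulrC.
by apply: in_idealN; apply: in_ideal_gen.
Qed.

Section Unprojection.
Variables (k : fieldType) (a m : nat).
Hypotheses (a_ge3 : (3 <= a)%N) (m_gt : (a.*2 < m)%N).
Local Notation N := m.+2.
Local Notation P := {mpoly k[m.+3]}.
Local Notation x := (xvar k N).
Local Notation fc mu := (face a m (msp mu)).

Let m_gt0 : (0 < m)%N. Proof. by move: m_gt; clear; lia. Qed.
Let m_le : (m <= N.+1)%N. Proof. by clear; lia. Qed.

(* [x m.+1], [x m.+2] and [x m.+3] are the variables [z_1], [z_2] and [T]. *)
Definition Lgens (f : P) : Prop :=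
  [\/ Igens x a m f,
      exists2 v, Igen x a.-1 2 m.-2 v & f = x m.+3 * v
    | exists2 w, Igen x a.-2 3 (m - 3) w &
        f = (x m.+3 * (x m.+1 * x m.+2) - x 1%N * x m.-1 * x m) * w].

HB.instance Definition _ := GRing.RMorphism.copy (@embRP k m)
  (comp_mpoly [tuple 'X_(widen_ord (leqnSn m.+2) i) | i < m.+2]).

Lemma embRP_var (i : nat) : (i < m.+2)%N -> embRP ('X_(inord i) : {mpoly k[m.+2]}) = 'X_(inord i).
Proof.
move=> lt_i; rewrite /embRP comp_mpolyXU -tnth_nth tnth_mktuple; congr 'X_ _.
by apply/val_inj; rewrite /= !inordK //; move: lt_i; clear; lia.
Qed.

Lemma embRP_xR i : (1 <= i <= m)%N -> embRP (xR k m i) = x i.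
Proof. by move=> i_in; apply: embRP_var; move: i_in; clear; lia. Qed.

Lemma embRP_prod t : all (within 1 m) t -> embRP (\prod_(i <- t) xR k m i) = \prod_(i <- t) x i.
Proof.
move=> /allP t_in; rewrite rmorph_prod; apply: eq_big_seq => i /t_in i_in.
exact: embRP_xR.
Qed.

Lemma embRP_Igen n p q g : (1 <= p)%N -> (q <= m)%N ->
  Igen (xR k m) n p q g -> Igen x n p q (embRP g).
Proof.
move=> p_ge q_le [t [sz so t_in ->]]; exists t; split=> //; apply: embRP_prod.
by apply: sub_all t_in => i; rewrite /within; move: p_ge q_le; clear; lia.
Qed.

Lemma embRP_Igen_inv n p q g : (1 <= p)%N -> (q <= m)%N ->
  Igen x n p q g -> exists2 g0, Igen (xR k m) n p q g0 & g = embRP g0.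
Proof.
move=> p_ge q_le [t [sz so t_in ->]]; exists (\prod_(i <- t) xR k m i).
  by exists t.
rewrite embRP_prod //.
by apply: sub_all t_in => i; rewrite /within; move: p_ge q_le; clear; lia.
Qed.

Lemma embRP_Igens g : Igens (xR k m) a m g -> Igens x a m (embRP g).
Proof.
case=> [hg|[w [hw ->]]].
  by left; apply: embRP_Igen => //; apply: leq_pred.
right; exists (embRP w); split; first by apply: embRP_Igen => //; clear; lia.
by rewrite !rmorphM /= !embRP_xR // ?m_gt0 ?leqnn.
Qed.

Lemma embRP_yz : (embRP (z1R k m * z2R k m) = x m.+1 * x m.+2) *
  (embRP (xR k m 1 * xR k m m.-1 * xR k m m) = x 1%N * x m.-1 * x m).
Proof.
split; first by rewrite rmorphM /= /z1R /z2R !embRP_var //; clear; lia.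
by rewrite !rmorphM /= !embRP_xR //; move: m_gt a_ge3; clear; lia.
Qed.

(** The relation [T u - phi(u)] is linear in the data that represent [u], so it is a combination of
    those for the generators [v] and [z_1 z_2 w], up to [T] times an element of [I]. *)
Lemma Sgens_Lgens f : in_ideal (@Sgens k a m) f <-> in_ideal Lgens f.
Proof.
split; apply: in_ideal_trans => {}f; last first.
  have le2 : (m.-2 <= m)%N by clear; lia.
  have le3 : (m - 3 <= m)%N by clear; lia.
  case=> [hf|[v /(@embRP_Igen_inv a.-1 2 m.-2 _ isT le2)[v0 hv0 ->] ->]
    |[w /(@embRP_Igen_inv a.-2 3 (m - 3) _ isT le3)[w0 hw0 ->] ->]].
  - by apply: in_ideal1; left.
  - apply: in_ideal1; right; exists v0, 0; split; last by rewrite rmorph0 subr0.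
    exists [:: (1, v0)], [::], 0; split=> //.
    + by move=> q; rewrite inE => /eqP ->.
    + exact: in_ideal0.
    + by rewrite big_seq1 big_nil !addr0 mul1r.
    + by rewrite big_nil.
  - apply: in_ideal1; right; exists (z1R k m * z2R k m * w0),
      (xR k m 1 * xR k m m.-1 * xR k m m * w0); split.
      exists [::], [:: (1, w0)], 0; split=> //.
      * by move=> q; rewrite inE => /eqP ->.
      * exact: in_ideal0.
      * by rewrite big_seq1 big_nil !addr0 add0r mul1r.
      * by rewrite big_seq1 mul1r.
    by rewrite !(rmorphM _ _ w0) /= !embRP_yz -[TP k m]/(x m.+3); ring.
case=> [hf|[u [p [[rs [ss [io [hrs hss hio -> ->]]]] ->]]]].
  by apply: in_ideal1; constructor 1.
have -> : TP k m * embRP (\sum_(q <- rs) q.1 * q.2 +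
       \sum_(q <- ss) q.1 * (z1R k m * z2R k m * q.2) + io) -
     embRP (\sum_(q <- ss) q.1 * (xR k m 1 * xR k m m.-1 * xR k m m * q.2)) =
   \sum_(q <- rs) embRP q.1 * (x m.+3 * embRP q.2) +
   \sum_(q <- ss) embRP q.1 * ((x m.+3 * (x m.+1 * x m.+2) - x 1%N * x m.-1 * x m) * embRP q.2)
   + x m.+3 * embRP io.
  have e1 : \sum_(q <- rs) embRP q.1 * (x m.+3 * embRP q.2) =
      x m.+3 * embRP (\sum_(q <- rs) q.1 * q.2).
    rewrite rmorph_sum mulr_sumr; apply: eq_bigr => q _.
    by rewrite rmorphM mulrCA.
  have e2 : \sum_(q <- ss) embRP q.1 *
        ((x m.+3 * (x m.+1 * x m.+2) - x 1%N * x m.-1 * x m) * embRP q.2) =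
      x m.+3 * embRP (\sum_(q <- ss) q.1 * (z1R k m * z2R k m * q.2)) -
      embRP (\sum_(q <- ss) q.1 * (xR k m 1 * xR k m m.-1 * xR k m m * q.2)).
    rewrite !rmorph_sum mulr_sumr -sumrB; apply: eq_bigr => q _.
    by rewrite !(rmorphM _ q.1) !(rmorphM _ _ q.2) /= !embRP_yz; ring.
  by rewrite e1 e2 !rmorphD /= -[TP k m]/(x m.+3); ring.
apply: in_idealD; first apply: in_idealD.
- apply: in_ideal_sum => q /hrs hq; apply: in_ideal_gen; constructor 2.
  by exists (embRP q.2) => //; apply: embRP_Igen hq; clear; lia.
- apply: in_ideal_sum => q /hss hq; apply: in_ideal_gen; constructor 3.
  by exists (embRP q.2) => //; apply: embRP_Igen hq; clear; lia.
- apply: in_idealM; apply: in_ideal_morph hio => g hg; apply: in_ideal1.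
  by constructor 1; apply: embRP_Igens.
Qed.

End Unprojection.

(** * The normal form and the regular sequence *)

Section NormalForm.
Variables (k : fieldType) (a m : nat).
Hypotheses (a_ge3 : (3 <= a)%N) (m_gt : (a.*2 < m)%N).
Local Notation N := m.+2.
Local Notation P := {mpoly k[m.+3]}.
Local Notation x := (xvar k N).
Local Notation fc mu := (face a m (msp mu)).
Local Notation ix i := (inord i.-1 : 'I_N.+1).
Local Notation L := (in_ideal (@Lgens k a m)).

Let m_gt0 : (0 < m)%N. Proof. by move: m_gt; clear; lia. Qed.
Let m_le : (m <= N.+1)%N. Proof. by clear; lia. Qed.

Let ey : 'X_{1..m.+3} := mset N [:: 1; m.-1; m]%N.
Let eZ : 'X_{1..m.+3} := mset N [:: m.+3; m.+1; m.+2]%N.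

Let prod_y : x 1%N * x m.-1 * x m = 'X_[ey].
Proof. by rewrite -prod_xvar !big_cons big_nil mulr1 mulrA. Qed.

Let prod_Z : x m.+3 * (x m.+1 * x m.+2) = 'X_[eZ].
Proof. by rewrite -prod_xvar !big_cons big_nil mulr1. Qed.

Let ey_range i : i \in [:: 1; m.-1; m]%N -> (0 < i <= N.+1)%N.
Proof. by rewrite !inE; move: m_gt a_ge3; clear; lia. Qed.

Let eZ_range i : i \in [:: m.+3; m.+1; m.+2]%N -> (0 < i <= N.+1)%N.
Proof. by rewrite !inE; clear; lia. Qed.

Let msp_ey i : (0 < i <= N.+1)%N -> msp ey i = (i \in [:: 1; m.-1; m]%N).
Proof. by move=> i_in; apply: msp_mset_uniq => // j; apply: ey_range. Qed.

Let msp_eZ i : (0 < i <= N.+1)%N -> msp eZ i = (i \in [:: m.+3; m.+1; m.+2]%N).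
Proof. by move=> i_in; apply: msp_mset_uniq => // j; apply: eZ_range. Qed.

(** The exponent of the largest power of [y] dividing the monomial. *)
Definition emin (mu : 'X_{1..m.+3}) : nat :=
  minn (mu (ix 1)) (minn (mu (ix m.-1)) (mu (ix m))).

Lemma emin_le mu i : i \in [:: 1; m.-1; m]%N -> (emin mu <= mu (ix i))%N.
Proof.
by rewrite !inE /emin => /or3P[] /eqP ->; rewrite !geq_min leqnn ?orbT.
Qed.

Let eyP j : ey j = 0%N \/ ey j = 1%N /\ exists2 i, i \in [:: 1; m.-1; m]%N & j = ix i.
Proof.
rewrite msetE count_uniq_mem; last first.
  rewrite map_inj_in_uniq => [|i i' hi hi']; last by apply: ix_inj; apply: ey_range.
  by rewrite /= !inE; move: m_gt a_ge3; clear; lia.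
by case: mapP => [[i hi ->]|_]; [right; split=> //; exists i|left].
Qed.

Let ey_in i : i \in [:: 1; m.-1; m]%N -> ey (ix i) = 1%N.
Proof.
move=> hi; have := msp_ey (ey_range hi); rewrite hi /msp.
by have [->|[->]] := eyP (ix i).
Qed.

Lemma emin_addy mu : emin (mu + ey) = (emin mu).+1.
Proof.
by rewrite /emin !mnmDE !ey_in ?inE ?eqxx ?orbT // !addn1 !minnSS.
Qed.

Lemma emin_add (mu d : 'X_{1..m.+3}) : (forall i, i \in [:: 1; m.-1; m]%N -> ~~ msp d i) ->
  emin (mu + d) = emin mu.
Proof.
move=> hd; have d0 i : i \in [:: 1; m.-1; m]%N -> d (ix i) = 0%N.
  by move=> /hd; rewrite /msp -eqn0Ngt => /eqP.
by rewrite /emin !mnmDE !d0 ?inE ?eqxx ?orbT // !addn0.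
Qed.

Lemma nu_msp_add (mu d : 'X_{1..m.+3}) p q : (0 < p)%N -> (q <= N.+1)%N ->
  (forall i, (p <= i <= q)%N -> ~~ msp d i) -> nu (msp (mu + d)) p q = nu (msp mu) p q.
Proof.
by move=> p_gt0 q_le hd; apply: nu_eq => i i_in; rewrite mspD (negPf (hd _ i_in)) orbF.
Qed.

Lemma face_msp_add (mu d : 'X_{1..m.+3}) :
  (forall i, (1 <= i <= m)%N -> ~~ msp d i) -> fc (mu + d) = fc mu.
Proof.
move=> hd; apply: eq_face => // i i_in.
by rewrite mspD (negPf (hd _ i_in)) orbF.
Qed.

(** The monomials of the ideal generated by [I] and all [T v]. *)
Definition dead (mu : 'X_{1..m.+3}) : bool :=
  ~~ fc mu || msp mu m.+3 && (a.-1 <= nu (msp mu) 2 m.-2)%N.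

Definition has_w (mu : 'X_{1..m.+3}) : bool := (a.-2 <= nu (msp mu) 3 (m - 3))%N.

Definition swap (mu : 'X_{1..m.+3}) : 'X_{1..m.+3} :=
  (mu - ey *+ emin mu + eZ *+ emin mu)%MM.

(* The normal form with respect to the rewriting rule
   [x_1 x_(m-1) x_m w --> T z_1 z_2 w], applied as often as possible. *)
Definition nf (mu : 'X_{1..m.+3}) : P :=
  if dead mu then 0 else if has_w mu then 'X_[swap mu] else 'X_[mu].

Lemma nf_congr mu : L ('X_[mu] - nf mu).
Proof.
rewrite /nf; case: ifP => [|_].
  case/orP => [nfmu|/andP[muT /nu_witP[t ht mu_t]]]; rewrite subr0.
    have : in_ideal (Igens x a m) 'X_[mu].
      by apply/(in_Igens m_gt0 m_le) => // nu; rewrite msuppX inE => /eqP ->.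
    by apply: in_ideal_trans => g hg; apply: in_ideal1; constructor 1.
  have le_mu : (mset N (m.+3 :: t) <= mu)%MM.
    rewrite mset_le_uniq /= ?muT //.
      have /and3P[_ /spread_uniq -> _] := ht; rewrite andbT.
      by apply/negP => /(spr_in ht); clear; lia.
    move=> i; rewrite inE => /orP[/eqP ->|/(spr_in ht)]; first by clear; lia.
    by clear; lia.
  rewrite -(submK le_mu) mpolyXD; apply: in_ideal_gen; constructor 2.
  exists 'X_[mset N t]; last by rewrite mset_cons mpolyXD.
  by apply/IgenP; exists (mset N t) => //; exists t.
case: ifP => [/nu_witP[t ht mu_t]|_]; last by rewrite subrr; apply: in_ideal0.
have le_t : (mset N t <= mu)%MM by rewrite (mset_le _ ht) //; clear; lia.
have le_j j : (ey j * emin mu + mset N t j <= mu j)%N.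
  have [->|[-> [i hi ->]]] := eyP j; first by have := mnm_lepP le_t j; clear; lia.
  have : ~~ msp (mset N t) i.
    rewrite (msp_mset ht) //; try by [clear; lia|apply: ey_range].
    apply/negP => /(spr_in ht); move: hi; rewrite !inE; move: m_gt a_ge3; clear; lia.
  rewrite /msp -eqn0Ngt => /eqP ->.
  by have := emin_le mu hi; clear; lia.
pose r := (mu - (ey *+ emin mu + mset N t))%MM.
have def_mu : mu = (r + (ey *+ emin mu + mset N t))%MM.
  by rewrite submK //; apply/mnm_lepP => j; rewrite mnmDE mulmnE; apply: le_j.
have -> : swap mu = (r + (eZ *+ emin mu + mset N t))%MM.
  apply/mnmP => j; rewrite /swap /r !(mnmDE, mnmBE, mulmnE).
  by have := le_j j; clear; lia.
rewrite {1}def_mu !mpolyXD -!mpolyXn -mulrBr -mulrBl; apply: in_idealM.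
apply: subXX_ideal; constructor 3; exists 'X_[mset N t]; last by rewrite -prod_y -prod_Z.
by apply/IgenP; exists (mset N t) => //; exists t.
Qed.

Let ey_out i : (2 <= i <= m.-2)%N -> ~~ msp ey i.
Proof.
move=> i_in; rewrite msp_ey ?inE; last by move: i_in; clear; lia.
by move: i_in m_gt a_ge3; clear; lia.
Qed.

Let eZ_out i : (1 <= i <= m)%N -> ~~ msp eZ i.
Proof.
move=> i_in; rewrite msp_eZ ?inE; last by move: i_in; clear; lia.
by move: i_in; clear; lia.
Qed.

(** Confluence: by [nface_v] and [nface_colon] both [mu + ey] and [mu + eZ] are dead exactly when
    some [v] divides [mu]. Otherwise the factor [ey] raises [emin] by one while [eZ] leaves it
    alone, and the two swapped monomials agree. *)
Lemma nf_swap mu : has_w mu -> nf (mu + eZ) = nf (mu + ey).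
Proof.
move=> w_mu.
have nu_y p q : (2 <= p)%N -> (q <= m.-2)%N -> nu (msp (mu + ey)) p q = nu (msp mu) p q.
  move=> hp hq; apply: nu_msp_add => [||i i_in]; [by move: hp; clear; lia| |].
    by move: hq; clear; lia.
  by apply: ey_out; move: hp hq i_in; clear; lia.
have nu_Z p q : (1 <= p)%N -> (q <= m)%N -> nu (msp (mu + eZ)) p q = nu (msp mu) p q.
  move=> hp hq; apply: nu_msp_add => [||i i_in] //; first by move: hq; clear; lia.
  by apply: eZ_out; move: hp hq i_in; clear; lia.
have hwy : has_w (mu + ey) by rewrite /has_w nu_y //; clear; lia.
have hwZ : has_w (mu + eZ) by rewrite /has_w nu_Z //; clear; lia.
have dead_y : dead (mu + ey) = (a.-1 <= nu (msp mu) 2 m.-2)%N.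
  rewrite /dead nu_y //; apply/orP/idP => [[|/andP[_]//]|le_v].
    by move/(nface_v); rewrite nu_y.
  left; apply: nface_colon => //; rewrite ?nu_y //; try by clear; lia.
  - by rewrite mspD msp_ey ?inE ?eqxx ?orbT.
  - by rewrite mspD msp_ey ?inE ?eqxx ?orbT //; apply: ey_range; rewrite !inE eqxx orbT.
  - by rewrite mspD msp_ey ?inE ?eqxx ?orbT //; apply: ey_range; rewrite !inE eqxx !orbT.
have dead_Z : dead (mu + eZ) = (a.-1 <= nu (msp mu) 2 m.-2)%N.
  have le2 : (m.-2 <= m)%N by clear; lia.
  have -> : dead (mu + eZ) = ~~ fc mu || (a.-1 <= nu (msp mu) 2 m.-2)%N.
    rewrite /dead face_msp_add // nu_Z // mspD msp_eZ ?inE ?eqxx ?orbT //; clear; lia.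
  by apply/orP/idP => [[/nface_v//|//]|]; right.
rewrite /nf dead_y dead_Z hwy hwZ; case: ifP => // _; congr 'X_[_].
rewrite /swap emin_addy emin_add; last first.
  by move=> i hi; apply: eZ_out; move: hi; rewrite !inE; move: m_gt a_ge3; clear; lia.
apply/mnmP => j; rewrite !(mnmDE, mnmBE, mulmnE) !mulnS.
have : (ey j * emin mu <= mu j)%N.
  have [->//|[-> [i hi ->]]] := eyP j.
  by rewrite mul1n; apply: emin_le.
clear; lia.
Qed.

Lemma nf_kills f : L f -> lin_ext nf f = 0.
Proof.
elim/in_ideal_ind: f / => [|f g IHf IHg|r g Lg]; first exact: lin_ext0.
  by rewrite lin_extD IHf IHg addr0.
apply: lin_extM_eq0 => mu {r}; case: Lg.
- move=> /(in_ideal_gen 'X_[mu])/(in_Igens m_gt0 m_le _ a_ge3 m_gt) nfmu.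
  rewrite /lin_ext big1_seq // => nu /andP[_ /nfmu]; rewrite /nf /dead => ->.
  by rewrite scaler0.
- case=> v /IgenP[d [t ht ->] ->] ->; rewrite -mpolyXD -mpolyXD lin_extX /nf.
  suff -> : dead (mu + (U_(ix m.+3) + mset N t)) by [].
  apply/orP; right; apply/andP; split.
    by rewrite 2!mspD mspU ?eqxx ?orbT //; clear; lia.
  apply/nu_witP; exists t => //; apply/allP => i it; have i_in := spr_in ht it.
  rewrite 2!mspD (msp_mset ht) ?it ?orbT //; first by clear; lia.
  by move: i_in; clear; lia.
- case=> w /IgenP[d [t ht ->] ->] ->.
  rewrite prod_y prod_Z mulrBl mulrBr -!mpolyXD lin_extD lin_extN !lin_extX.
  rewrite [(eZ + _)%MM]addmC [(ey + _)%MM]addmC !addmA nf_swap ?subrr //.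
  apply/nu_witP; exists t => //; apply/allP => i it; have i_in := spr_in ht it.
  rewrite mspD (msp_mset ht) ?it ?orbT //; first by clear; lia.
  by move: i_in; clear; lia.
Qed.

(** None of [dead], [has_w] and [emin] looks at the exponent of [z_1]. *)
Lemma nf_zeta mu : nf (mu + U_(ix m.+1)) = 'X_(ix m.+1) * nf mu.
Proof.
have out i : (1 <= i <= N.+1)%N -> i != m.+1 -> ~~ msp (U_(ix m.+1) : 'X_{1..m.+3}) i.
  by move=> i_in ne; rewrite mspU 1?eq_sym //; clear; lia.
have hz i : (1 <= i <= m)%N -> ~~ msp (U_(ix m.+1) : 'X_{1..m.+3}) i.
  by move=> i_in; apply: out; move: i_in; clear; lia.
have nu_z p q : (1 <= p)%N -> (q <= m)%N ->
    nu (msp (mu + U_(ix m.+1))) p q = nu (msp mu) p q.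
  move=> hp hq; apply: nu_msp_add => [||i i_in] //; first by move: hq; clear; lia.
  by apply: hz; move: hp hq i_in; clear; lia.
have -> : nf (mu + U_(ix m.+1)) = if dead mu then 0 else if has_w mu then
    'X_[swap (mu + U_(ix m.+1))] else 'X_[mu + U_(ix m.+1)].
  rewrite /nf /dead /has_w face_msp_add // !nu_z //; try by clear; lia.
  by rewrite mspD (negPf (out m.+3 _ _)) ?orbF //; clear; lia.
rewrite /nf; case: ifP => _; first by rewrite mulr0.
case: ifP => _; rewrite -mpolyXD; congr 'X_[_]; last by rewrite addmC.
rewrite /swap emin_add; last first.
  by move=> i hi; apply: hz; move: hi; rewrite !inE; move: m_gt a_ge3; clear; lia.
apply/mnmP => j; rewrite !(mnmDE, mnmBE, mulmnE).
have : (ey j * emin mu <= mu j)%N.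
  have [->//|[-> [i hi ->]]] := eyP j.
  by rewrite mul1n; apply: emin_le.
clear; lia.
Qed.

Lemma lin_ext_nf_congr f : L (f - lin_ext nf f).
Proof.
rewrite {1}(mpolyE f) /lin_ext -sumrB; apply: in_ideal_sum => mu _.
by rewrite -scalerBr -mul_mpolyC; apply: in_idealM; apply: nf_congr.
Qed.

(** The normal form of [z_1 f] is [z_1] times that of [f], and the polynomial ring is a domain, so
    [f] has normal form zero. *)
Lemma z1_regular f : L (x m.+1 * f) -> L f.
Proof.
move=> /nf_kills.
have -> : lin_ext nf (x m.+1 * f) = x m.+1 * lin_ext nf f.
  rewrite {1}(mpolyE f) mulr_sumr lin_ext_sum [in RHS]/lin_ext mulr_sumr.
  apply: eq_bigr => mu _.
  rewrite -!scalerAr lin_extZ; congr (_ *: _).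
  by rewrite -mpolyXD lin_extX addmC nf_zeta.
move/eqP; rewrite mulf_eq0 => /orP[/eqP/(congr1 (mcoeff U_(ix m.+1)))|/eqP nf0].
  by rewrite mcoeffX eqxx mcoeff0 => /eqP; rewrite oner_eq0.
by have := lin_ext_nf_congr f; rewrite nf0 subr0.
Qed.

(* Modulo [z_1], the generators [(T z_1 z_2 - y) w] become the monomials [y w]
   of the last case. *)
Definition lim_list (s : seq nat) : Prop :=
  [\/ spr a 2 m.-1 s,
      exists2 t, spr a.-1 3 m.-2 t & s = [:: 1; m]%N ++ t,
      exists2 t, spr a.-1 2 m.-2 t & s = m.+3 :: t
    | exists2 t, spr a.-2 3 (m - 3) t & s = [:: 1; m.-1; m]%N ++ t].

Lemma lim_list_range s : lim_list s ->
  s != [::] /\ {in s, forall i, (0 < i <= m)%N || (i == m.+3)}.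
Proof.
have ne n p q t : spr n p q t -> (0 < n)%N -> t != [::].
  by move=> /and3P[/eqP <- _ _]; case: t.
case=> [hs|[t ht ->]|[t ht ->]|[t ht ->]]; split=> //.
- by apply: ne hs _; move: a_ge3; clear; lia.
- by move=> i /(spr_in hs); clear; lia.
- move=> i; rewrite mem_cat !inE => /orP[|/(spr_in ht)]; last by clear; lia.
  by move: m_gt0; clear; lia.
- move=> i; rewrite inE => /orP[/eqP ->|/(spr_in ht)]; last by clear; lia.
  by rewrite eqxx orbT.
- move=> i; rewrite mem_cat !inE => /orP[|/(spr_in ht)]; last by clear; lia.
  by move: m_gt a_ge3; clear; lia.
Qed.

Definition lim_gens (zs : seq nat) (f : P) : Prop :=
  exists2 d, (exists2 s, lim_list s \/ (exists2 z, z \in zs & s = [:: z]) & d = mset N s)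
           & f = 'X_[d].

(** Stated for any list containing [z_1], so as to serve both [S/(z_1)] and [S/(z_1, z_2)]. *)
Lemma Sgens_lim (zs : seq nat) f : (m.+1 \in zs) ->
  in_ideal (gen_union (@Sgens k a m) [seq x i | i <- zs]) f <-> in_ideal (lim_gens zs) f.
Proof.
move=> z1_in.
have SL g : L g -> in_ideal (gen_union (@Sgens k a m) [seq x i | i <- zs]) g.
  move=> /(Sgens_Lgens a_ge3 m_gt); apply: in_ideal_trans => h hh.
  by apply: in_ideal1; left.
have limZ z : z \in zs -> in_ideal (lim_gens zs) (x z).
  move=> hz; apply: in_ideal1; exists (mset N [:: z]).
    by exists [:: z] => //; right; exists z.
  by rewrite -prod_xvar big_seq1.
have lim1 s : lim_list s -> in_ideal (lim_gens zs) 'X_[mset N s].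
  by move=> hs; apply: in_ideal1; exists (mset N s) => //; exists s => //; left.
have LS g : @Lgens k a m g -> in_ideal (lim_gens zs) g.
  case=> [/IgensP[d [[t ht ->]|[t ht ->]] ->]|[v /IgenP[d [t ht ->] ->] ->]
    |[w /IgenP[d [t ht ->] ->] ->]].
  - by apply: lim1; constructor 1.
  - rewrite -addmA -2!mset_cons; apply: lim1; constructor 2; by exists t.
  - by rewrite -mpolyXD -mset_cons; apply: lim1; constructor 3; exists t.
  - rewrite mulrBl; apply: in_idealB.
      have -> : x m.+3 * (x m.+1 * x m.+2) * 'X_[mset N t] =
                (x m.+3 * x m.+2 * 'X_[mset N t]) * x m.+1 by ring.
      by apply: in_idealM; apply: limZ.
    rewrite prod_y -mpolyXD -mset_cat; apply: lim1; constructor 4; by exists t.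
split.
  apply: in_ideal_trans => g [Sg|/mapP[z hz ->]]; last exact: limZ.
  have /(Sgens_Lgens a_ge3 m_gt) : in_ideal (@Sgens k a m) g by apply: in_ideal1.
  exact: in_ideal_trans.
apply: in_ideal_trans => g [d [s [hs|[z hz ->]] ->] ->]; last first.
  by rewrite -prod_xvar big_seq1; apply: in_ideal1; right; apply: map_f.
have genI n p q t : spr n p q t -> Igen x n p q 'X_[mset N t].
  by move=> ht; apply/IgenP; exists (mset N t) => //; exists t.
case: hs => [hs|[t ht ->]|[t ht ->]|[t ht ->]].
- by apply/SL/in_ideal1; constructor 1; left; apply: genI.
- apply/SL/in_ideal1; constructor 1; right; exists 'X_[mset N t]; split; first exact: genI.
  by rewrite mset_cat mpolyXD -prod_xvar !big_cons big_nil mulr1.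
- apply/SL/in_ideal1; constructor 2; exists 'X_[mset N t]; first exact: genI.
  by rewrite mset_cons mpolyXD.
- rewrite mset_cat mpolyXD -[mset N [:: _; _; _]]/ey -prod_y.
  have -> : x 1%N * x m.-1 * x m * 'X_[mset N t] =
      (x m.+3 * x m.+2 * 'X_[mset N t]) * x m.+1 -
      (x m.+3 * (x m.+1 * x m.+2) - x 1%N * x m.-1 * x m) * 'X_[mset N t] by ring.
  apply: in_idealB.
    by apply/in_idealM/in_ideal1; right; apply: map_f.
  by apply/SL/in_ideal1; constructor 3; exists 'X_[mset N t] => //; apply: genI.
Qed.

Lemma Sregular : regular_seq (@Sgens k a m) [:: z1P k m; z2P k m].
Proof.
have noU f : in_ideal (gen_union (@Sgens k a m) [::]) f <-> L f.
  rewrite -(Sgens_Lgens a_ge3 m_gt).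
  by split; apply: in_ideal_trans => g; [case=> // hg|move=> hg]; apply: in_ideal1 => //; left.
split=> [[|[|//]] _ f|] /=.
- by move/noU => /z1_regular /noU.
- rewrite -[[:: z1P k m]]/[seq x i | i <- [:: m.+1]].
  rewrite !Sgens_lim ?mem_head // => /(in_mono_ideal (fun g => iff_refl _)) H.
  apply/(in_mono_ideal (fun g => iff_refl _)) => mu mu_in.
  (* No generator involves [z_2], so one that divides [z_2] times the monomial [mu] divides [mu]. *)
  have [] := H (U_(ix m.+2) + mu)%MM.
    by rewrite mcoeff_msupp mcoeffXM -mcoeff_msupp.
  move=> d [s hs ->] le_d; exists (mset N s); first by exists s.
  apply/mnm_lepP => j; have := mnm_lepP le_d j; rewrite mnmDE mnm1E.
  have [<-|_] //= := eqVneq (ix m.+2) j.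
  suff : ~~ msp (mset N s) m.+2 by rewrite /msp -eqn0Ngt => /eqP ->.
  have s_in : {in s, forall i, (0 < i <= N.+1)%N && (i != m.+2)}.
    case: hs => [/lim_list_range[_ h] i|[z hz -> i]]; first by move/h; clear; lia.
    by move: hz; rewrite !inE => /eqP -> /eqP ->; clear; lia.
  rewrite msp_mset_uniq; [|by move=> i /s_in /andP[]|by clear; lia].
  by apply/negP => /s_in; rewrite eqxx andbF.
- rewrite -[[:: z1P k m; z2P k m]]/[seq x i | i <- [:: m.+1; m.+2]].
  rewrite Sgens_lim ?mem_head // => /(in_mono_ideal (fun g => iff_refl _)) H.
  have [] := H 0%MM; first by rewrite msupp1 inE.
  move=> d [s hs ->] /mnm_lepP le0.
  have [s_ne s_in] : s != [::] /\ {in s, forall i, (0 < i <= N.+1)%N}.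
    case: hs => [/lim_list_range[h1 h2]|[z]].
      by split=> // i /h2; clear; lia.
    by move=> hz ->; split=> // i; rewrite inE => /eqP ->; move: hz; rewrite !inE; clear; lia.
  case: s s_ne s_in le0 {hs} => // i s _ s_in /(_ (ix i)).
  rewrite mnm0E leqn0; have := @msp_mset_uniq N (i :: s) i s_in (s_in _ (mem_head _ _)).
  by rewrite mem_head /msp lt0n => /negPf ->.
Qed.

End NormalForm.

(** * Faces of the cyclic polytope *)

Section Alternation.
Variable R : realFieldType.

(** The sum is the coefficient of [X^n] in the Lagrange interpolant [q] of [p] at the [n+1] points,
    and [q] equals [p]. *)
Lemma lagrange_lead n (s : 'I_n.+1 -> R) (p : {poly R}) :
  injective s -> (size p <= n)%N ->
  \sum_k p.[s k] / \prod_(l | l != k) (s k - s l) = 0.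
Proof.
move=> inj_s sz_p.
pose c k := p.[s k] / \prod_(l | l != k) (s k - s l).
pose q : {poly R} := \sum_k c k *: \prod_(l | l != k) ('X - (s l)%:P).
have sz_prod k : size (\prod_(l | l != k) ('X - (s l)%:P)) = n.+1.
  rewrite -big_filter size_prod_XsubC size_filter -sum1_count; congr _.+1.
  transitivity #|predC1 k|; last by rewrite cardC1 card_ord.
  by rewrite -sum1_card; apply: eq_bigl => l; rewrite !inE.
have nz k : \prod_(l | l != k) (s k - s l) != 0.
  apply/prodf_neq0 => l; rewrite subr_eq0; apply: contra => /eqP/inj_s ->.
  exact: eqxx.
have q_s k : q.[s k] = p.[s k].
  rewrite /q horner_sum (bigD1 k) //= [X in _ + X]big1 ?addr0 => [|l ne_lk].
    rewrite hornerZ horner_prod.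
    rewrite (eq_bigr (fun l => s k - s l)) => [|l _]; last by rewrite hornerXsubC.
    by rewrite /c divfK.
  rewrite hornerZ horner_prod (bigD1 k) 1?eq_sym //= hornerXsubC subrr mul0r.
  exact: mulr0.
have eq_qp : q = p.
  apply/eqP; rewrite -subr_eq0; apply/negPn/negP => nz_qp.
  have sz_qp : (size (q - p)%R <= n.+1)%N.
    apply: leq_trans (size_polyD _ _) _; rewrite size_polyN geq_max (leqW sz_p) andbT.
    apply: (big_ind (fun r : {poly R} => (size r <= n.+1)%N)).
    - by rewrite size_poly0.
    - by move=> r r' hr hr'; apply: leq_trans (size_polyD _ _) _; rewrite geq_max hr.
    - by move=> k _; apply: leq_trans (size_scale_leq _ _) _; rewrite sz_prod.
  have := max_poly_roots nz_qp (rs := [seq s k | k <- enum 'I_n.+1]).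
  rewrite map_inj_uniq ?enum_uniq // size_map size_enum_ord ltnNge sz_qp.
  move=> H; suff : false by []; apply: H => //.
  by apply/allP => _ /mapP[k _ ->]; rewrite rootE hornerD hornerN q_s subrr.
have : q`_n = 0 by rewrite eq_qp nth_default.
rewrite /q coef_sum => q_n; rewrite -[RHS]q_n; apply: eq_bigr => k _; rewrite coefZ.
suff -> : (\prod_(l | l != k) ('X - (s l)%:P))`_n = 1 by rewrite mulr1.
have /monicP : \prod_(l | l != k) ('X - (s l)%:P) \is monic by apply: monic_prod_XsubC.
by rewrite lead_coefE sz_prod.
Qed.

Lemma sum_gt n k : (\sum_(l < n) (k < l)%N)%N = (n - k.+1)%N.
Proof. by elim: n => [|n IHn]; rewrite ?big_ord0 // big_ord_recr /= IHn; lia. Qed.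

(** Exactly the [n - k] factors with [l > k] are negative. *)
Lemma lagrange_sign n (s : 'I_n.+1 -> R) (k : 'I_n.+1) :
  (forall i j : 'I_n.+1, (i < j)%N -> s i < s j) ->
  0 < (-1) ^+ (n - k) * \prod_(l | l != k) (s k - s l).
Proof.
move=> s_inc.
have -> : (-1) ^+ (n - k) = \prod_(l < n.+1 | l != k) (-1) ^+ (k < l)%N :> R.
  rewrite -(big_morph _ (exprD (-1)) (expr0 (-1))); congr (_ ^+ _).
  have := sum_gt n.+1 k; rewrite (bigD1 k) //= ltnn add0n => ->.
  by rewrite subSS.
rewrite -big_split; apply: prodr_gt0 => l ne_lk /=.
have [lt_kl|lt_lk|/val_inj eq_kl] := ltngtP k l.
- by rewrite expr1 mulN1r opprB subr_gt0; apply: s_inc.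
- by rewrite expr0 mul1r subr_gt0; apply: s_inc.
- by rewrite eq_kl eqxx in ne_lk.
Qed.

(** The alternating signs cancel those of the denominators, so all terms of the vanishing sum in
    [lagrange_lead] have the same sign. Hence each is zero, and [p] has more roots than its degree
    allows. *)
Lemma alternation n (s : 'I_n.+1 -> R) (p : {poly R}) :
  (forall i j : 'I_n.+1, (i < j)%N -> s i < s j) -> (size p <= n)%N ->
  (forall k : 'I_n.+1, 0 <= (-1) ^+ k * p.[s k]) -> p = 0.
Proof.
move=> s_inc sz_p p_alt.
have inj_s : injective s.
  move=> i j eq_s; apply/val_inj; have [lt|lt|//] := ltngtP i j;
  by have := s_inc _ _ lt; rewrite eq_s ltxx.
have p0 k : p.[s k] = 0.
  have := lagrange_lead inj_s sz_p; move/(congr1 (fun z => (-1) ^+ n * z)).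
  rewrite mulr0 mulr_sumr => /eqP; rewrite psumr_eq0 => [/allP/(_ k)|l _].
    rewrite mem_index_enum => /(_ isT) /=.
    rewrite !mulf_eq0 signr_eq0 invr_eq0 /= => /orP[/eqP //|].
    have := lagrange_sign k s_inc.
    by case: eqP => [->|]; rewrite ?mulr0 ?ltxx.
  have e : (-1) ^+ n = (-1) ^+ (n - l) * (-1) ^+ l :> R.
    by rewrite -exprD subnK // -ltnS.
  rewrite e -mulrA [X in _ * X]mulrA mulrA [_ * (_ * p.[s l])]mulrC -mulrA.
  apply: mulr_ge0; first exact: p_alt.
  have := lagrange_sign l s_inc; set X := \prod_(_ | _) _ => hX.
  have -> : (-1) ^+ (n - l) / X = ((-1) ^+ (n - l) * X)^-1.
    by rewrite invfM -exprVn invrN1.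
  by rewrite invr_ge0 ltW.
apply/eqP/negPn/negP => nz_p.
have := max_poly_roots nz_p (rs := [seq s k | k <- enum 'I_n.+1]).
rewrite map_inj_uniq ?enum_uniq // size_map size_enum_ord ltnNge (leqW sz_p).
move=> H; suff : false by []; apply: H => //.
by apply/allP => _ /mapP[k _ ->]; rewrite rootE p0.
Qed.

End Alternation.

(** Sample points for the alternation argument: for [i] in a nonface, [p] vanishes at [T i], which
    counts as nonpositive, and is nonnegative at [T i.+1]. *)
Definition doubled (s : seq nat) : seq nat := flatten [seq [:: i; i.+1] | i <- s].

Lemma doubledP s (y : nat) : y \in doubled s ->
  exists2 x : nat, x \in s & (x <= y <= x.+1)%N.
Proof.
case/flattenP => _ /mapP[x xs ->]; rewrite !inE => y_in; exists x => //.
by move: y_in; clear; lia.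
Qed.

Lemma size_doubled s : size (doubled s) = (size s).*2.
Proof. by elim: s => //= x s ->. Qed.

Lemma doubled_inc s : pairwise spread s -> pairwise ltn (doubled s).
Proof.
elim: s => //= x s IHs /andP[/allP hx /IHs ->]; rewrite andbT ltnSn /=.
have h (y : nat) : y \in doubled s -> (x.+1 < y)%N.
  by case/doubledP => z /hx; rewrite /spread; clear; lia.
by apply/andP; split; apply/allP => y /h //; apply: ltnW.
Qed.

(** * Nonnegative polynomials on the parameters of the moment curve *)

Section Moment.
Variables (R : realFieldType) (n : nat) (T : nat -> R).
Hypothesis T_inc : forall i j, (0 < i)%N -> (i < j)%N -> (j <= n)%N -> T i < T j.

Fixpoint alt_signs (b : bool) (p : {poly R}) (l : seq nat) : bool :=
  if l is i :: l' then (0 <= (-1) ^+ b * p.[T i]) && alt_signs (~~ b) p l' else true.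

Lemma alt_signs_nth b p l : alt_signs b p l ->
  forall k, (k < size l)%N -> 0 <= (-1) ^+ b * ((-1) ^+ k * p.[T (nth 0%N l k)]).
Proof.
elim: l b => // i l IHl b /= /andP[h1 h2] [_|k lt_k]; first by rewrite expr0 mul1r.
have := IHl _ h2 k lt_k; rewrite exprS.
by case: b {h1 h2} => /=; rewrite ?expr0 ?expr1 ?mul1r ?mulN1r ?mulNr ?opprK ?mulN1r.
Qed.

Lemma alternation_list b (p : {poly R}) l : pairwise ltn l -> all (within 1 n) l ->
  (size p < size l)%N -> alt_signs b p l -> p = 0.
Proof.
move=> inc_l /allP l_in sz_p /alt_signs_nth p_alt.
case: l inc_l l_in sz_p p_alt => // i l; set l' := i :: l => inc_l l_in sz_p p_alt.
suff : (-1) ^+ b *: p = 0.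
  by move/eqP; rewrite scaler_eq0 signr_eq0 => /eqP.
apply: (@alternation R (size l) (fun k => T (nth 0%N l' k))).
- move=> j j' lt_j; have lt_s (h : 'I_(size l).+1) : (h < size l')%N := ltn_ord h.
  have /andP[h1 _] := l_in _ (mem_nth 0%N (lt_s j)).
  have /andP[_ h2] := l_in _ (mem_nth 0%N (lt_s j')).
  by apply: T_inc => //; move/(pairwiseP 0%N): inc_l; apply; rewrite ?inE.
- by apply: leq_trans (size_scale_leq _ _) _.
- by move=> k; rewrite hornerZ mulrCA; apply: p_alt.
Qed.

Lemma alt_signs_doubled p s l : (forall i, i \in s -> p.[T i] = 0) ->
  (forall i, i \in s -> 0 <= p.[T i.+1]) ->
  alt_signs true p (doubled s ++ l) = alt_signs true p l.
Proof.
elim: s => //= x s IHs h0 h1.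
rewrite h0 ?mem_head // mulr0 lexx expr0 mul1r h1 ?mem_head //=.
by apply: IHs => i hi; [apply: h0|apply: h1]; rewrite inE hi orbT.
Qed.

(** A supporting hyperplane restricted to the moment curve: [b - c.f(t)] is a polynomial in [t] of
    degree at most the dimension. *)
Definition covers (p : {poly R}) (c : nat) (W : pred nat) : Prop :=
  (size p <= c.+1)%N /\
  forall i, (1 <= i <= n)%N -> 0 <= p.[T i] /\ (p.[T i] == 0) = W i.

Lemma covers_mul p q c c' (W W' Z : pred nat) : covers p c W -> covers q c' W' ->
  (forall i, (1 <= i <= n)%N -> Z i = W i || W' i) -> covers (p * q) (c + c') Z.
Proof.
move=> [sz_p hp] [sz_q hq] hZ; split.
  by apply: leq_trans (size_polyMleq _ _) _; move: sz_p sz_q; clear; lia.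
move=> i i_in; have [p0 pW] := hp i i_in; have [q0 qW] := hq i i_in.
by rewrite hornerM mulf_eq0 pW qW hZ // mulr_ge0.
Qed.

Lemma T_eq i j : (1 <= i <= n)%N -> (1 <= j <= n)%N -> (T i == T j) = (i == j).
Proof.
move=> hi hj; apply/eqP/eqP => [eq_T|->//].
have [lt|lt|//] := ltngtP i j.
- by have := T_inc _ lt _; rewrite eq_T ltxx => H; suff: false by []; apply: H; lia.
- by have := T_inc _ lt _; rewrite eq_T ltxx => H; suff: false by []; apply: H; lia.
Qed.

Lemma T_le i j : (1 <= i)%N -> (i <= j)%N -> (j <= n)%N -> T i <= T j.
Proof.
move=> hi; rewrite leq_eqVlt => /orP[/eqP ->//|lt] hj.
by apply: ltW; apply: T_inc.
Qed.

Lemma covers_first : (0 < n)%N -> covers ('X - (T 1)%:P) 1 (pred1 1%N).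
Proof.
move=> n_gt0; split; first by rewrite size_XsubC.
move=> i i_in; rewrite hornerXsubC subr_ge0 subr_eq0 T_eq ?n_gt0 //; split=> //.
by apply: T_le; move: i_in; clear; lia.
Qed.

Lemma covers_last : (0 < n)%N -> covers ((T n)%:P - 'X) 1 (pred1 n).
Proof.
move=> n_gt0; split; first by rewrite -opprB size_polyN size_XsubC.
move=> i i_in; rewrite -opprB hornerN hornerXsubC opprB subr_ge0 subr_eq0 eq_sym.
rewrite T_eq ?n_gt0 ?leqnn //; split=> //.
by apply: T_le; move: i_in; clear; lia.
Qed.

Lemma covers_pair j j' : (1 <= j)%N -> (j <= j' <= j.+1)%N -> (j' <= n)%N ->
  covers (('X - (T j)%:P) * ('X - (T j')%:P)) 2 (pred2 j j').
Proof.
move=> hj hjj hj'; split.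
  by apply: leq_trans (size_polyMleq _ _) _; rewrite !size_XsubC.
move=> i i_in; rewrite hornerM !hornerXsubC mulf_eq0 !subr_eq0 !T_eq //; last 2 first.
- by move: hj hjj hj'; clear; lia.
- by move: hj hjj hj'; clear; lia.
split=> //; have [le_ij|lt_ji] := leqP i j.
  apply: mulr_le0; rewrite subr_le0; apply: T_le; move: i_in hjj hj' le_ij; clear; lia.
by apply: mulr_ge0; rewrite subr_ge0; apply: T_le; move: i_in hj hjj lt_ji; clear; lia.
Qed.

(** The greedy choice in [nu] costs degree 2 per entry: at [p] in [W] use the factor with roots
    [T p], [T p.+1] if [p+1] is in [W] too, and with the double root [T p] if not. No parameter lies
    strictly between the two roots, so the factor is nonnegative. *)
Lemma cover_interval (W : pred nat) p q : (1 <= p)%N -> (q <= n)%N ->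
  exists P, covers P (nu W p q).*2 (fun i => (p <= i <= q)%N && W i).
Proof.
move=> + q_le; move: p; apply: (nu_ind (q := q)) => [p lt_qp|p le_pq IH1 IH2] hp.
  exists 1; split; first by rewrite size_poly1.
  move=> i i_in; rewrite hornerE ler01 oner_eq0; split=> //.
  by have -> : (p <= i <= q)%N = false by [move: lt_qp; clear; lia].
rewrite nuE //; case: ifP => Wp.
  have [Q cQ] := IH2 isT.
  have [c2|c2] := boolP ((p < q)%N && W p.+1).
    have hpair := @covers_pair p p.+1 hp ltac:(clear; lia) ltac:(move: c2; lia).
    eexists; apply: (covers_mul hpair cQ) => i i_in /=.
    have [->|n1] := eqVneq i p; first by rewrite Wp andbT leqnn.
    have [->|n2] := eqVneq i p.+1; first by move: c2; rewrite leqnSn.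
    by congr (_ && _); move: n1 n2; clear; lia.
  have hpair := @covers_pair p p hp ltac:(clear; lia) ltac:(lia).
  eexists; apply: (covers_mul hpair cQ) => i i_in /=.
  have [->|n1] := eqVneq i p; first by rewrite Wp andbT leqnn.
  have [->|n2] := eqVneq i p.+1.
    by rewrite leqnSn /= (negPf c2) ltnn.
  by congr (_ && _); move: n1 n2; clear; lia.
have [Q [sz hQ]] := IH1 isT; exists Q; split=> // i i_in.
have [h1 ->] := hQ i i_in; split=> //.
have [->|n1] := eqVneq i p; first by rewrite Wp !andbF.
by congr (_ && _); move: n1; clear; lia.
Qed.

Lemma covers_eq p c c' (W Z : pred nat) : covers p c W -> (c <= c')%N ->
  (forall i, (1 <= i <= n)%N -> Z i = W i) -> covers p c' Z.
Proof.
move=> [sz h] le_c hZ; split; first exact: leq_trans sz _.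
by move=> i i_in; rewrite hZ //; apply: h.
Qed.

Variable a : nat.
Hypotheses (a_ge3 : (3 <= a)%N) (n_gt : (a.*2.+1 < n)%N).

Lemma face_cover (W : pred nat) : face a n W -> exists p, covers p a.*2.-1 W.
Proof.
move=> /andP[lt_nu2 lt_nu3].
have n_gt0 : (0 < n)%N by move: n_gt; clear; lia.
have [W1n|W1n] := boolP (W 1%N && W n); last first.
  have [Q cQ] := @cover_interval W 2 n.-1 isT (leq_pred n).
  have inside i : (1 <= i <= n)%N -> i != 1%N -> i != n -> (2 <= i <= n.-1)%N.
    by clear; lia.
  have [W1|W1] := boolP (W 1%N).
    have Wn : W n = false by move: W1n; rewrite W1; case: (W n).
    eexists; apply: covers_eq (covers_mul (covers_first n_gt0) cQ (fun _ _ => erefl)) _ _.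
      by move: lt_nu2 a_ge3; clear; lia.
    move=> i i_in /=; have [->|n1] := eqVneq i 1%N; first by rewrite W1.
    have [->|n2] := eqVneq i n; first by rewrite Wn andbF.
    by rewrite inside.
  have [Wn|Wn] := boolP (W n).
    eexists; apply: covers_eq (covers_mul (covers_last n_gt0) cQ (fun _ _ => erefl)) _ _.
      by move: lt_nu2 a_ge3; clear; lia.
    move=> i i_in /=; have [->|n1] := eqVneq i n; first by rewrite Wn.
    have [->|n2] := eqVneq i 1%N; first by rewrite (negPf W1) andbF.
    by rewrite inside.
  exists Q; apply: covers_eq cQ _ _ => [|i i_in].
    by move: lt_nu2 a_ge3; clear; lia.
  have [->|n1] := eqVneq i 1%N; first by rewrite (negPf W1).
  have [->|n2] := eqVneq i n; first by rewrite (negPf Wn) andbF.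
  by rewrite inside.
rewrite W1n /= in lt_nu3; have /andP[W1 Wn] := W1n.
have [/allP W_all|/allPn[i]] := boolP (all W (iota 2 (n - 2))).
  have : (n.-1.+1 - 2 <= (nu W 2 n.-1).*2)%N.
    by apply: nu_full => i i_in; apply: W_all; rewrite mem_iota; move: i_in; clear; lia.
  by move: lt_nu2 n_gt; clear; lia.
rewrite mem_iota => i_in Wi.
have i_gt0 : (0 < i)%N by move: i_in; clear; lia.
have g1 : (nu W 2 i.-1 + nu W i.+1 n.-1 <= nu W 2 n.-1)%N.
  by apply: nu_gap; move: i_in; clear; lia.
have g2 : (nu W 3 i.-1 + nu W i.+1 n.-2 <= nu W 3 n.-2)%N.
  by apply: nu_gap; move: i_in; clear; lia.
have w1 := nu_widenl W 2 i.-1; have w2 := nu_widenr W i.+1 n.-1.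
have s1 := nu_splitN 2 n.-2 i_gt0 Wi; have s2 := nu_splitN 3 n.-1 i_gt0 Wi.
(* Cutting both counts at the missing [i] and exchanging the right halves bounds their sum by
   [(a-1) + (a-2)], so one of them is at most [a-2]. *)
have [hA|hB] : (nu W 2 n.-2 <= a.-2)%N \/ (nu W 3 n.-1 <= a.-2)%N.
- by move: g1 g2 w1 w2 s1 s2 lt_nu2 lt_nu3; clear; lia.
(* Degree count: 1 for the vertex 1, at most [2(a-2)] for [2, n-2], and 2 for the pair n-1, n or 1
   for n alone, in total at most [2a-1]. *)
- have [Q cQ] := @cover_interval W 2 n.-2 isT ltac:(clear; lia).
  have cQ1 := covers_mul (covers_first n_gt0) cQ (fun _ _ => erefl).
  have [Wn1|Wn1] := boolP (W n.-1).
    have hpair := @covers_pair n.-1 n ltac:(move: n_gt; clear; lia)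
      ltac:(clear; lia) (leqnn n).
    eexists; apply: covers_eq (covers_mul hpair cQ1 (fun _ _ => erefl)) _ _.
      by move: hA a_ge3; clear; lia.
    move=> j j_in /=; have [->|n1] := eqVneq j n; first by rewrite Wn orbT.
    have [->|n2] := eqVneq j n.-1; first by rewrite Wn1.
    have [->|n3] := eqVneq j 1%N; first by rewrite W1 !orbT.
    have -> : (2 <= j <= n.-2)%N by move: j_in n1 n2 n3; clear; lia.
    by [].
  eexists; apply: covers_eq (covers_mul (covers_last n_gt0) cQ1 (fun _ _ => erefl)) _ _.
    by move: hA a_ge3; clear; lia.
  move=> j j_in /=; have [->|n1] := eqVneq j n; first by rewrite Wn.
  have [->|n3] := eqVneq j 1%N; first by rewrite W1 !orbT.
  have [->|n2] := eqVneq j n.-1; first by rewrite (negPf Wn1) andbF.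
  have -> : (2 <= j <= n.-2)%N by move: j_in n1 n2 n3; clear; lia.
  by [].
- have [Q cQ] := @cover_interval W 3 n.-1 isT (leq_pred n).
  have cQ1 := covers_mul (covers_last n_gt0) cQ (fun _ _ => erefl).
  have [W2|W2] := boolP (W 2%N).
    have hpair := @covers_pair 1 2 isT isT ltac:(move: n_gt; clear; lia).
    eexists; apply: covers_eq (covers_mul hpair cQ1 (fun _ _ => erefl)) _ _.
      by move: hB a_ge3; clear; lia.
    move=> j j_in /=; have [->|n1] := eqVneq j 1%N; first by rewrite W1.
    have [->|n2] := eqVneq j 2%N; first by rewrite W2 orbT.
    have [->|n3] := eqVneq j n; first by rewrite Wn !orbT.
    have -> : (3 <= j <= n.-1)%N by move: j_in n1 n2 n3; clear; lia.
    by [].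
  eexists; apply: covers_eq (covers_mul (covers_first n_gt0) cQ1 (fun _ _ => erefl)) _ _.
    by move: hB a_ge3; clear; lia.
  move=> j j_in /=; have [->|n1] := eqVneq j 1%N; first by rewrite W1.
  have [->|n3] := eqVneq j n; first by rewrite Wn !orbT.
  have [->|n2] := eqVneq j 2%N; first by rewrite (negPf W2) andbF.
  have -> : (3 <= j <= n.-1)%N by move: j_in n1 n2 n3; clear; lia.
  by [].
Qed.

Lemma cover_face (W : pred nat) p : covers p a.*2.-1 W -> p != 0 -> face a n W.
Proof.
move=> [sz_p hp]; apply: contraNT => nf; apply/eqP.
have p_ge0 i : (1 <= i <= n)%N -> 0 <= p.[T i] by case/hp.
have p_W i : (1 <= i <= n)%N -> W i -> p.[T i] = 0.
  by move=> /hp[_ <-] /eqP.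
have sz_p' : (size p <= a.*2)%N by move: sz_p a_ge3; clear; lia.
move: nf; rewrite /face negb_and -leqNgt negb_imply -leqNgt.
case/orP => [/nu_witP[s hs /allP Ws]|/andP[/andP[W1 Wn] /nu_witP[s hs /allP Ws]]].
  have /and3P[/eqP sz_s sp_s _] := hs.
  have s_in i : i \in s -> (2 <= i <= n.-1)%N by apply: spr_in hs.
  case def_s: s sz_s => [|x s'] sz_s; first by move: a_ge3 sz_s; clear => /=; lia.
  have xs : x \in s by rewrite def_s mem_head.
  have x_le y : y \in s -> (x <= y)%N.
    rewrite def_s inE => /orP[/eqP ->//|ys].
    move: sp_s; rewrite def_s pairwise_cons => /andP[/allP/(_ _ ys)].
    by rewrite /spread; clear; lia.
  (* The point before the first entry starts the sign pattern with a plus, giving [2a+1] points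
     against a degree of at most [2a-1]. *)
  apply: (@alternation_list false p (x.-1 :: doubled s)).
  - rewrite pairwise_cons doubled_inc // andbT; apply/allP => y /doubledP[z zs].
    by have := x_le _ zs; have := s_in _ xs; clear => /=; lia.
  - apply/allP => y; rewrite inE => /orP[/eqP ->|/doubledP[z zs]].
      by have := s_in _ xs; rewrite /within; clear; lia.
    by have := s_in _ zs; rewrite /within; clear; lia.
  - by rewrite /= size_doubled def_s sz_s ltnS.
  - rewrite /= expr0 mul1r p_ge0 /=; last by have := s_in _ xs; clear; lia.
    rewrite -[doubled s]cats0 alt_signs_doubled // => i hi.
      by apply: p_W; [have := s_in _ hi; clear; lia|apply: Ws].
    by apply: p_ge0; have := s_in _ hi; clear; lia.
have /and3P[/eqP sz_s sp_s _] := hs.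
have s_in i : i \in s -> (3 <= i <= n.-2)%N by apply: spr_in hs.
(* The two zeros at 1 and n count as nonpositive, so 1, 2, the doubled [a-1] entries and n form
   again an alternating list of [2a+1] points. *)
apply: (@alternation_list true p ([:: 1; 2]%N ++ doubled s ++ [:: n])).
- rewrite !pairwise_cat doubled_inc //=.
  rewrite !allrel_catr /= !andbT -andbA; apply/and3P; split.
  + by apply/allrelP => y z; rewrite !inE => hy /doubledP[w /s_in]; move: hy; clear => /=; lia.
  + by apply/allrelP => y z; rewrite !inE => + /eqP ->; move: n_gt a_ge3; clear => /=; lia.
  + by apply/allrelP => y z /doubledP[w /s_in]; rewrite inE => + + /eqP ->; clear => /=; lia.
- apply/allP => y; rewrite !mem_cat => /or3P[|/doubledP[z zs]|].
  + by rewrite !inE /within; move: n_gt a_ge3; clear; lia.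
  + by have := s_in _ zs; rewrite /within; clear; lia.
  + by rewrite inE => /eqP ->; rewrite /within; move: n_gt a_ge3; clear; lia.
- by rewrite !size_cat size_doubled sz_s; move: sz_p' a_ge3; clear => /=; lia.
- have n_in : (1 <= 1 <= n)%N /\ (1 <= n <= n)%N /\ (1 <= 2 <= n)%N.
    by move: n_gt a_ge3; clear; lia.
  case: n_in => h1 [h2 h3].
  rewrite /= p_W // mulr0 lexx expr0 mul1r p_ge0 //=.
  rewrite alt_signs_doubled /=.
  + by rewrite p_W // mulr0 lexx.
  + by move=> i hi; apply: p_W; [have := s_in _ hi; clear; lia|apply: Ws].
  + by move=> i hi; apply: p_ge0; have := s_in _ hi; clear; lia.
Qed.

End Moment.

Lemma nu_pred0 (W : pred nat) p q : (forall i, ~~ W i) -> nu W p q = 0%N.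
Proof.
move=> W0; have [[|i t] [<- _ _ //=]] := nu_wit W p q.
by rewrite (negPf (W0 i)).
Qed.

(** * The Stanley-Reisner ideal of the cyclic polytope *)

Section CyclicPolytope.
Variables (k : fieldType) (R : realType) (a m : nat) (t : 'I_m.+1 -> R).
Hypotheses (a_ge3 : (3 <= a)%N) (m_gt : (a.*2 < m)%N).
Hypothesis t_inc : forall i j : 'I_m.+1, (i < j)%N -> t i < t j.
Local Notation d := a.*2.-1.

Definition vset (W : {set 'I_m.+1}) : pred nat := fun i => inord i.-1 \in W.

Let T (i : nat) : R := t (inord i.-1).

Let T_inc i j : (0 < i)%N -> (i < j)%N -> (j <= m.+1)%N -> T i < T j.
Proof. by move=> h1 h2 h3; apply: t_inc; rewrite !inordK; move: h1 h2 h3; clear; lia. Qed.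

Let n_gt : (a.*2.+1 < m.+1)%N. Proof. by []. Qed.

Let TS (i : 'I_m.+1) : T i.+1 = t i. Proof. by rewrite /T /= inord_val. Qed.

Lemma cyc_faceP (W : {set 'I_m.+1}) : cyc_face d t W <-> face a m.+1 (vset W).
Proof.
split.
  case=> [->|[c [b [c_le defW WT]]]].
    by rewrite /face !nu_pred0 /vset => [|i|i]; rewrite ?inE //; move: a_ge3; clear; lia.
  pose p : {poly R} := b%:P - \sum_(j < d) c j *: 'X^(j.+1).
  have pE i : p.[T i] = b - \sum_(j < d) c j * T i ^+ j.+1.
    rewrite /p hornerD hornerN hornerC horner_sum; congr (_ - _).
    by apply: eq_bigr => j _; rewrite hornerZ hornerXn.
  apply: (@cover_face R m.+1 T T_inc a a_ge3 n_gt _ p).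
    split=> [|i i_in].
      apply: leq_trans (size_polyD _ _) _; rewrite size_polyN geq_max.
      apply/andP; split; first by apply: leq_trans (size_polyC_leq1 _) _.
      apply: (big_ind (fun r : {poly R} => (size r <= d.+1)%N)) => [|r r' hr hr'|j _].
      - by rewrite size_poly0.
      - by apply: leq_trans (size_polyD _ _) _; rewrite geq_max hr.
      - by apply: leq_trans (size_scale_leq _ _) _; rewrite size_polyXn ltnS ltn_ord.
    by rewrite pE subr_ge0 subr_eq0 /vset defW inE eq_sym; split=> //; apply: c_le.
  (* If [p] were zero, every vertex would lie on the hyperplane. *)
  apply: contraNneq WT => p0; apply/eqP/setP => i; rewrite defW !inE.
  have := pE i.+1; rewrite p0 horner0 TS => /esym/eqP.
  by rewrite subr_eq0 eq_sym.
move=> fW; right; have [p [sz_p hp]] := face_cover T_inc a_ge3 n_gt fW.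
(* With these coefficients, [b - c.f(t)] is [p] evaluated at [t]. *)
exists (fun j => - p`_j.+1), p`_0.
have pE i : \sum_(j < d) - p`_j.+1 * t i ^+ j.+1 = p`_0 - p.[t i].
  rewrite (horner_coef_wide _ sz_p) big_ord_recl expr0 mulr1 opprD addrA subrr sub0r.
  by rewrite -sumrN; apply: eq_bigr => j _; rewrite mulNr.
have i_in (i : 'I_m.+1) : (1 <= i.+1 <= m.+1)%N by have := ltn_ord i; clear; lia.
split.
- move=> i; rewrite pE gerBl -TS; by case: (hp _ (i_in i)).
- apply/setP => i; rewrite inE pE -subr_eq0 addrAC subrr sub0r oppr_eq0 -TS.
  by case: (hp _ (i_in i)) => _ ->; rewrite /vset /= inord_val.
- apply/negP => /eqP WT; have /andP[lt_nu _] := fW.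
  have : (m.+1 - 2 <= (nu (vset W) 2 m).*2)%N.
    by apply: nu_full => i _; rewrite /vset WT inE.
  by move: lt_nu m_gt; clear => /=; lia.
Qed.

(** Because nonfaces are described by the same predicate [face], the Stanley-Reisner ideal has the
    shape of [I] with m+1 in place of m. *)
Lemma in_SRgens f :
  in_ideal (@SRgens k R d m.+1 t) f <-> in_ideal (Igens (xvar k m) a m.+1) f.
Proof.
pose dW (W : {set 'I_m.+1}) : 'X_{1..m.+1} := (\sum_(i in W) U_(i))%MM.
have dWE W j : dW W j = (j \in W).
  rewrite /dW mnm_sumE; have [jW|jW] := boolP (j \in W).
    rewrite (bigD1 j) //= mnm1E eqxx big1 ?addn0 // => i /andP[_ ne].
    by rewrite mnm1E (negPf ne).
  by rewrite big1 // => i iW; rewrite mnm1E; case: eqP => // e; rewrite -e iW in jW.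
have GP g : @SRgens k R d m.+1 t g <->
    exists2 e, (exists2 W, ~ cyc_face d t W & e = dW W) & g = 'X_[e].
  split=> [[W [hW ->]]|[e [W hW ->] ->]].
    by exists (dW W); [exists W|rewrite /dW mprodXE].
  by exists W; rewrite /dW mprodXE.
rewrite (in_mono_ideal GP) (in_Igens (m := m.+1)) //; last by move: m_gt; clear; lia.
split=> H mu /H => [[_ [W hW ->] /mnm_lepP le_mu]|nf].
  apply/negP => fmu; apply: hW; apply/cyc_faceP; apply: face_sub fmu => // i i_in.
  by rewrite /vset => iW; have := le_mu (inord i.-1); rewrite dWE iW.
pose W := [set i : 'I_m.+1 | (0 < mu i)%N].
exists (dW W); last by apply/mnm_lepP => j; rewrite dWE inE; case: (mu j).
exists W => // /cyc_faceP; apply/negP; apply: contra nf; apply: face_sub => // i i_in.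
by rewrite /vset inE.
Qed.

End CyclicPolytope.

(** * The isomorphism with the Stanley-Reisner ring *)

Lemma spr_last n p q s : spr n p q s ->
  spr n p q.-1 s \/ exists2 t, spr n.-1 p (q - 2) t & s = rcons t q.
Proof.
move=> hs; have /and3P[/eqP sz sp s_in] := hs.
case/lastP: s hs sz sp s_in => [|s x] hs sz sp s_in.
  by left; rewrite /spr sz eqxx.
have [def_x|ne_x] := eqVneq x q.
  right; exists s; last by rewrite def_x.
  move: sp; rewrite -cats1 pairwise_cat => /and3P[/allrelP lt_x sp _].
  apply/and3P; split=> //; first by apply/eqP; rewrite -sz size_rcons.
  apply/allP => y ys; have := lt_x y x ys; rewrite inE eqxx => /(_ isT).
  have := spr_in hs (i := y); rewrite mem_rcons inE ys orbT => /(_ isT).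
  by rewrite def_x /spread /within; clear; lia.
left; apply/and3P; split=> //; first exact/eqP.
apply/allP => y; rewrite mem_rcons inE => /orP[/eqP ->|ys].
  have := spr_in hs (i := x); rewrite mem_rcons mem_head => /(_ isT).
  by rewrite /within; move: ne_x; clear; lia.
have := spr_in hs (i := x); rewrite mem_rcons mem_head => /(_ isT).
have := spr_in hs (i := y); rewrite mem_rcons inE ys orbT => /(_ isT).
move: sp; rewrite -cats1 pairwise_cat => /and3P[/allrelP/(_ y x ys)].
by rewrite inE eqxx => /(_ isT); rewrite /within /spread; clear; lia.
Qed.

Lemma spr_rcons n p q r s : spr n p q s -> (q.+2 <= r)%N -> (p <= r)%N ->
  spr n.+1 p r (rcons s r).
Proof.
move=> hs qr pr; rewrite -cats1 -addn1.
by apply: (spr_cat (r := r) (s := r)) hs _ _ _ _ => //;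
  rewrite /spr /= /within ?leqnn //; move: qr; clear; lia.
Qed.

Lemma linformX (k : fieldType) n (i : 'I_n) : linform ('X_i : {mpoly k[n]}).
Proof. by rewrite /linform msuppX /= mdeg1. Qed.

Lemma linform0 (k : fieldType) n : linform (0 : {mpoly k[n]}).
Proof. by rewrite /linform msupp0. Qed.

Section Iso.
Variables (k : fieldType) (a m : nat).
Hypotheses (a_ge3 : (3 <= a)%N) (m_gt : (a.*2 < m)%N).
Local Notation x := (xvar k m.+2).
Local Notation y := (xvar k m).

(** [T] takes the position m because [T v] then becomes the spread set of [v] followed by m, a
    generator of [I_(a,2,m)]. Likewise [y w] becomes [x_1 x_(m+1)] times the spread set of [w]
    followed by m-1. *)
Definition toSR (i : nat) : {mpoly k[m.+1]} :=
  if (i < m)%N then y i else if i == m then y m.+1 else if i == m.+3 then y m else 0.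

Definition ofSR (i : nat) : {mpoly k[m.+3]} :=
  if (i < m)%N then x i else if i == m then x m.+3 else x m.

Definition toSR_tuple := [tuple toSR i.+1 | i < m.+3].
Definition ofSR_tuple := [tuple ofSR i.+1 | i < m.+1].

Lemma comp_toSR i : (1 <= i <= m.+3)%N -> x i \mPo toSR_tuple = toSR i.
Proof.
move=> i_in; rewrite comp_mpolyXU -tnth_nth tnth_mktuple inordK ?prednK //;
  move: i_in; clear; lia.
Qed.

Lemma comp_ofSR i : (1 <= i <= m.+1)%N -> y i \mPo ofSR_tuple = ofSR i.
Proof.
move=> i_in; rewrite comp_mpolyXU -tnth_nth tnth_mktuple inordK ?prednK //;
  move: i_in; clear; lia.
Qed.

Lemma comp_toSR_prod s : {in s, forall i, (1 <= i <= m.+3)%N} ->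
  'X_[mset m.+2 s] \mPo toSR_tuple = \prod_(i <- s) toSR i.
Proof.
move=> s_in; rewrite -prod_xvar rmorph_prod; apply: eq_big_seq => i /s_in.
exact: comp_toSR.
Qed.

Lemma comp_ofSR_prod s : {in s, forall i, (1 <= i <= m.+1)%N} ->
  'X_[mset m s] \mPo ofSR_tuple = \prod_(i <- s) ofSR i.
Proof.
move=> s_in; rewrite -prod_xvar rmorph_prod; apply: eq_big_seq => i /s_in.
exact: comp_ofSR.
Qed.

Lemma toSR_low s : {in s, forall i, (i < m)%N} -> \prod_(i <- s) toSR i = 'X_[mset m s].
Proof.
by move=> s_in; rewrite -prod_xvar; apply: eq_big_seq => i /s_in lt; rewrite /toSR lt.
Qed.

Lemma ofSR_low s : {in s, forall i, (i < m)%N} -> \prod_(i <- s) ofSR i = 'X_[mset m.+2 s].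
Proof.
by move=> s_in; rewrite -prod_xvar; apply: eq_big_seq => i /s_in lt; rewrite /ofSR lt.
Qed.

Lemma toSR_high : (toSR m = y m.+1) * (toSR m.+3 = y m) *
  ((toSR m.+1 = 0) * (toSR m.+2 = 0)).
Proof.
rewrite /toSR ltnn !eqxx.
have [-> -> -> -> ->] : [/\ (m.+3 < m)%N = false, (m.+3 == m) = false,
  (m.+1 < m)%N = false, (m.+1 == m) = false & (m.+1 == m.+3) = false].
  by split; clear; lia.
have [-> -> ->] : [/\ (m.+2 < m)%N = false, (m.+2 == m) = false & (m.+2 == m.+3) = false].
  by split; clear; lia.
by [].
Qed.

Lemma ofSR_high : (ofSR m = x m.+3) * (ofSR m.+1 = x m).
Proof.
rewrite /ofSR ltnn !eqxx; have [-> ->] : (m.+1 < m)%N = false /\ (m.+1 == m) = false.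
  by split; clear; lia.
by [].
Qed.

Lemma S_to_SR f : in_ideal (gen_union (@Sgens k a m) [:: z1P k m; z2P k m]) f ->
  in_ideal (Igens y a m.+1) (f \mPo toSR_tuple).
Proof.
rewrite -[[:: z1P k m; z2P k m]]/[seq x i | i <- [:: m.+1; m.+2]].
rewrite Sgens_lim ?mem_head //; apply: (in_ideal_morph (h := comp_mpoly toSR_tuple)).
have genI n p q t : spr n p q t -> Igen y n p q 'X_[mset m t].
  by move=> ht; apply/IgenP; exists (mset m t) => //; exists t.
have lt1 : (1 < m)%N by move: m_gt a_ge3; clear; lia.
have ltm1 : (m.-1 < m)%N by move: lt1; clear; lia.
move=> g [_ [s [hs|[z hz ->]] ->] ->]; last first.
  rewrite /= comp_toSR_prod => [|i]; last first.
    by rewrite inE => /eqP ->; move: hz; rewrite !inE; clear; lia.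
  rewrite big_seq1; move: hz; rewrite !inE => /orP[] /eqP ->; rewrite toSR_high; exact: in_ideal0.
have [_ s_in] := lim_list_range a_ge3 m_gt hs.
rewrite /= comp_toSR_prod => [|i /s_in]; last by clear; lia.
apply: in_ideal1; case: hs => [hs|[t ht ->]|[t ht ->]|[t ht ->]].
- rewrite toSR_low => [|i /(spr_in hs)]; last by move: ltm1; clear; lia.
  by left; apply: genI; apply: spr_widen hs _ _; clear; lia.
- rewrite /= !big_cons toSR_low => [|i /(spr_in ht)]; last by move: ltm1; clear; lia.
  rewrite toSR_high mulrA /toSR lt1; right; exists 'X_[mset m t]; split=> //.
  by apply: genI; apply: spr_widen ht _ _; clear; lia.
- rewrite /= big_cons toSR_high toSR_low => [|i /(spr_in ht)]; last by move: ltm1; clear; lia.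
  left; rewrite -mpolyXD -mset_cons.
  have -> : mset m (m :: t) = mset m (rcons t m).
    by rewrite -cats1 mset_cat addmC -mset_cat.
  apply: genI; have {1}-> : a = a.-1.+1 by move: a_ge3; clear; lia.
  by apply: spr_rcons ht _ _; move: lt1; clear; lia.
- rewrite /= !big_cons toSR_low => [|i /(spr_in ht)]; last by move: ltm1; clear; lia.
  rewrite toSR_high /toSR lt1 ltm1; right; exists 'X_[mset m (rcons t m.-1)]; split.
    apply: genI; have {1}-> : a.-1 = a.-2.+1 by move: a_ge3; clear; lia.
    by apply: spr_rcons ht _ _; move: m_gt a_ge3; clear; lia.
  have ym1 : 'X_[mset m [:: m.-1]] = y m.-1 by rewrite -prod_xvar big_seq1.
  by rewrite -cats1 mset_cat mpolyXD ym1; ring.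
Qed.

Lemma SR_to_S f : in_ideal (Igens y a m.+1) f ->
  in_ideal (gen_union (@Sgens k a m) [:: z1P k m; z2P k m]) (f \mPo ofSR_tuple).
Proof.
rewrite -[[:: z1P k m; z2P k m]]/[seq x i | i <- [:: m.+1; m.+2]].
rewrite Sgens_lim ?mem_head //; apply: (in_ideal_morph (h := comp_mpoly ofSR_tuple)).
have lim1 s : lim_list a m s -> in_ideal (@lim_gens k a m [:: m.+1; m.+2]) 'X_[mset m.+2 s].
  by move=> hs; apply: in_ideal1; exists (mset m.+2 s) => //; exists s => //; left.
have lt1 : (1 < m)%N by move: m_gt a_ge3; clear; lia.
have ltm1 : (m.-1 < m)%N by move: lt1; clear; lia.
move=> g [/IgenP[_ [s hs ->] ->]|[w [/IgenP[_ [s hs ->] ->] ->]]].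
  rewrite /= comp_ofSR_prod => [|i /(spr_in hs)]; last by clear; lia.
  (* A spread set ending in m comes from some [T v], any other one from the first generators of
     [I]. *)
  case: (spr_last hs) => [hs'|[t ht ->]].
    rewrite ofSR_low => [|i /(spr_in hs')]; last by move: lt1; clear; lia.
    by apply: lim1; constructor 1.
  rewrite -cats1 big_cat big_seq1 /= ofSR_high ofSR_low => [|i /(spr_in ht)]; last first.
    by move: lt1; clear; lia.
  rewrite mulrC -mpolyXD -mset_cons; apply: lim1; constructor 3; exists t => //.
  by apply: spr_widen ht _ _; clear; lia.
rewrite !rmorphM /= !comp_ofSR; [|by clear; lia|by clear; lia].
rewrite comp_ofSR_prod => [|i /(spr_in hs)]; last by clear; lia.
have [of1 ofm1] : ofSR 1 = x 1%N /\ ofSR m.-1 = x m.-1 by rewrite /ofSR lt1 ltm1.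
rewrite ofSR_high of1.
(* A spread set ending in m-1 comes from some [y w], any other one from [x_1 x_m] times a generator
   of [I_(a-1,3,m-2)]. *)
case: (spr_last hs) => [hs'|[t ht ->]].
  rewrite ofSR_low => [|i /(spr_in hs')]; last by move: ltm1; clear; lia.
  rewrite -mulrA -!mpolyXD -!mset_cons; apply: lim1; constructor 2; exists s => //.
rewrite -cats1 big_cat big_seq1 /= ofm1 ofSR_low => [|i /(spr_in ht)]; last first.
  by move: lt1; clear; lia.
have -> : x 1%N * x m * ('X_[mset m.+2 t] * x m.-1) =
  x 1%N * (x m.-1 * (x m * 'X_[mset m.+2 t])) by ring.
rewrite -!mpolyXD -!mset_cons; apply: lim1; constructor 4; exists t => //.
by apply: spr_widen ht _ _; clear; lia.
Qed.

Lemma linform_toSR i : linform (toSR i).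
Proof.
by rewrite /toSR; do 3?[case: ifP => _]; rewrite ?linformX ?linform0.
Qed.

Lemma linform_ofSR i : linform (ofSR i).
Proof. by rewrite /ofSR; do 2?[case: ifP => _]; rewrite ?linformX. Qed.

Lemma S_iso_SR (R : realType) (t : 'I_m.+1 -> R) :
  (forall i j : 'I_m.+1, (i < j)%N -> t i < t j) ->
  graded_iso (gen_union (@Sgens k a m) [:: z1P k m; z2P k m])
             (@SRgens k R a.*2.-1 m.+1 t).
Proof.
move=> t_inc; exists toSR_tuple, ofSR_tuple; split.
- by split=> i; rewrite tnth_mktuple ?linform_toSR ?linform_ofSR.
- by move=> h /S_to_SR /(in_SRgens a_ge3 m_gt t_inc).
- by move=> h /(in_SRgens a_ge3 m_gt t_inc) /SR_to_S.
- move=> i; rewrite tnth_mktuple.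
  have i_in := ltn_ord i.
  have -> : 'X_i = x i.+1 by rewrite /xvar /= inord_val.
  have inside : toSR i.+1 \mPo ofSR_tuple = x i.+1 \/ (i.+1 \in [:: m.+1; m.+2]).
    have [lt|ge] := ltnP i.+1 m.
      left; rewrite /toSR lt comp_ofSR /ofSR ?lt //; move: lt; clear; lia.
    have [em|nm] := eqVneq i.+1 m.
      by left; rewrite em toSR_high comp_ofSR ?ofSR_high //; clear; lia.
    have [em|nm3] := eqVneq i.+1 m.+3.
      rewrite em toSR_high comp_ofSR ?ofSR_high; first by left.
      by move: m_gt a_ge3; clear; lia.
    by right; rewrite !inE; move: i_in ge nm nm3; clear; lia.
  case: inside => [->|z_in]; first by rewrite subrr; apply: in_ideal0.
  have -> : toSR i.+1 = 0 by move: z_in; rewrite !inE => /orP[] /eqP ->; rewrite toSR_high.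
  rewrite comp_mpoly0 subr0; apply: in_ideal1; right.
  by rewrite -[[:: z1P k m; z2P k m]]/[seq x i | i <- [:: m.+1; m.+2]]; apply: map_f.
- move=> i; rewrite tnth_mktuple.
  have i_in := ltn_ord i.
  have -> : 'X_i = y i.+1 by rewrite /xvar /= inord_val.
  suff -> : ofSR i.+1 \mPo toSR_tuple = y i.+1 by rewrite subrr; apply: in_ideal0.
  have [lt|ge] := ltnP i.+1 m.
    by rewrite /ofSR lt comp_toSR /toSR ?lt //; move: lt; clear; lia.
  have [em|nm] := eqVneq i.+1 m.
    by rewrite em ofSR_high comp_toSR ?toSR_high //; clear; lia.
  have -> : i.+1 = m.+1 by move: i_in ge nm; clear; lia.
  by rewrite ofSR_high comp_toSR ?toSR_high //; move: m_gt; clear; lia.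
Qed.

End Iso.

Theorem theorem4p4 (k : fieldType) (d m : nat) :
  odd d -> (5 <= d)%N -> (d < m.-1)%N ->
  let a := (d.+1)./2 in
  let I := in_ideal (Igens (xR k m) a m) in
  let J := in_ideal (Jgens (xR k m) (z1R k m) (z2R k m) a m) in
  let phi := phi_rel (xR k m) (z1R k m) (z2R k m) a m in
  let L := @Sgens k a m in
  [/\ (* I is contained in J *)
      (forall f, I f -> J f),
      (* phi is well defined as a map J/I -> R/I *)
      (forall u p p', phi u p -> phi u p' -> I (p - p')),
      (* Hom_{R/I}(J, R/I) is generated by phi and the inclusion *)
      (forall psi : {mpoly k[m.+2]} -> {mpoly k[m.+2]},
         (forall r u v, J u -> J v -> I (psi (r * u + v) - (r * psi u + psi v))) ->
         (forall u, I u -> I (psi u)) ->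
         exists alpha beta : {mpoly k[m.+2]},
           forall u p, phi u p -> I (psi u - (alpha * u + beta * p))),
      (* z1, z2 is an S-regular sequence *)
      regular_seq L [:: z1P k m; z2P k m]
    & (* S/(z1,z2) is isomorphic to k[Delta(d, m+1)] as graded k-algebras *)
      forall (R : realType) (t : 'I_m.+1 -> R),
        (forall i j : 'I_m.+1, (i < j)%N -> t i < t j) ->
        graded_iso (gen_union L [:: z1P k m; z2P k m]) (@SRgens k R d m.+1 t)].
Proof.
move=> odd_d d_ge5 d_lt a I J phi L.
have def_d : d = a.*2.-1 by rewrite /a; lia.
have a_ge3 : (3 <= a)%N by rewrite /a; lia.
have m_gt : (a.*2 < m)%N by rewrite /a; lia.
split.
- exact: idealI_sub_J.
- exact: phi_rel_welldef.
- exact: hom_generated.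
- exact: Sregular.
- by move=> R t t_inc; rewrite def_d; apply: S_iso_SR.
Qed.
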